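(* Let $\kappa_1,\kappa_2$ be two coefficient schedules on $[0,\infty)$, and let $\kappa_{\max}(t)=\max[\kappa_1(t),\kappa_2(t)]$ and $\kappa_{\min}(t)=\min[\kappa_1(t),\kappa_2(t)]$. Let $j_1,j_2,j_{\max},j_{\min}$ be the solutions, with $j(0)=0$ and $j'(0)=1$, of the Jacobi equation $j''(t)=\kappa(t)j(t)$ with $\kappa=\kappa_1,\kappa_2,\kappa_{\max},\kappa_{\min}$ respectively, each stopped at zero from its first positive zero on. Then for all $t\ge0$ $$j_{\max}(t)+j_{\min}(t)\ \ge\ j_1(t)+j_2(t).$$
   Context: Stopping convention: a solution follows its Jacobi equation as long as it is positive; if $t_*>0$ is the smallest positive time with $j(t_* )=0$, then $j(t)=0$ for all $t\ge t_*$. Schedules $\kappa$ may take both signs and may be continuous functions or weak limits of such, including measurable functions and sums of Dirac masses. Concretely: there is a locally finite positive Borel measure $\mu$ on $[0,\infty)$ (Lebesgue measure in the case of ordinary functions) such that each schedule is $\kappa_i(t)\,d\mu(t)$ with $\kappa_i$ locally $\mu$-integrable, maxima and minima being taken of these densities; $j''=\kappa j$ means that $j$ is continuous, $j'(0)$ is the right derivative at $0$, and the distributional second derivative of $j$ is $\kappa(t)\,j(t)\,d\mu(t)$. *)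

(* Defs.v *)
From HB Require Import structures.
From mathcomp Require Import all_boot all_order all_algebra.
From mathcomp Require Import all_classical all_reals all_analysis.

Set Implicit Arguments.
Unset Strict Implicit.
Unset Printing Implicit Defensive.

Import Order.TTheory GRing.Theory Num.Theory.
Import numFieldNormedType.Exports.

Local Open Scope classical_set_scope.
Local Open Scope ring_scope.

(* Objects on [0, +oo[ are represented by objects on the whole of R: measures,
   densities and solutions on the negative half-line are left unconstrained,
   since no definition below depends on them. *)

Definition locally_finite_on_halfline (R : realType)
    (mu : {measure set (measurableTypeR R) -> \bar R}) : Prop :=
  forall T : R, (mu `[0%R, T]%classic < +oo)%E.

Definition locally_integrable_on_halfline (R : realType)
    (mu : {measure set (measurableTypeR R) -> \bar R}) (kappa : R -> R) : Prop :=
  forall T : R, mu.-integrable `[0, T]%classic (EFin \o kappa).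

Definition smooth (R : realType) (phi : R -> R) : Prop :=
  forall (n : nat) (x : R), derivable (derive1n n phi) x 1.

Definition test_function (R : realType) (U : set R) (phi : R -> R) : Prop :=
  [/\ smooth phi,
      compact (closure [set x | phi x != 0]) &
      closure [set x | phi x != 0] `<=` U].

(* j'' = kappa j mu in the sense of distributions on ]0, T[ *)
Definition jacobi_equation (R : realType)
    (mu : {measure set (measurableTypeR R) -> \bar R}) (kappa j : R -> R)
    (T : R) : Prop :=
  forall phi : R -> R, test_function `]0, T[%classic phi ->
    \int[lebesgue_measure]_(t in `]0, T[%classic) (j t * derive1n 2 phi t) =
    \int[mu]_(t in `]0, T[%classic) (kappa t * j t * phi t).

Definition first_positive_zero (R : realType) (j : R -> R) (t : R) : Prop :=
  [/\ 0 < t, j t = 0 & forall s : R, 0 < s -> s < t -> j s != 0].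

(* The solution of j'' = kappa j mu with j(0) = 0 and right derivative
   j'(0) = 1, stopped at its first positive zero: the equation is required
   only on the intervals ]0, T[ on which j is positive. *)
Definition stopped_jacobi_solution (R : realType)
    (mu : {measure set (measurableTypeR R) -> \bar R}) (kappa j : R -> R)
    : Prop :=
  [/\ {within `[0, +oo[%classic, continuous j},
      j 0 = 0,
      (fun h : R => h^-1 * (j h - j 0)) @ 0^'+ --> (1 : R),
      forall T : R, (forall t : R, 0 < t -> t < T -> 0 < j t) ->
        jacobi_equation mu kappa j T &
      forall t0 t : R, first_positive_zero j t0 -> t0 <= t -> j t = 0].

(* Main.v *)
Require Import Defs.
From HB Require Import structures.
From mathcomp Require Import all_boot all_order all_algebra.
From mathcomp Require Import all_classical all_reals all_analysis.
From mathcomp Require Import measurable_realfun ring lra.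

Import Order.TTheory GRing.Theory Num.Theory.
Import numFieldNormedType.Exports.

Local Open Scope classical_set_scope.
Local Open Scope ring_scope.

Set Implicit Arguments.
Unset Strict Implicit.
Unset Printing Implicit Defensive.

(** Write [w = jmax + jmin - j1 - j2]. Sturm comparison shows that a stopped
    solution is nondecreasing in its coefficient ([stopped_monotone]), so [jmax]
    lies above [j1] and [j2], and [jmin] below them. Where [j1] vanishes, the
    claim is [jmax + jmin >= j2], which follows from [jmax >= j2]; likewise where
    [j2] vanishes. As long as [j1] and [j2] are positive, so is [jmax], and
    [[
      w'' - kappa1 w = (kappamax - kappa1) jmax + (kappamin - kappa1) jmin
                       - (kappa2 - kappa1) j2,
    ]]
    which is [(kappa2 - kappa1) (jmax - j2) >= 0] where [kappa1 <= kappa2] and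
    [(kappa1 - kappa2) (j2 - jmin) >= 0] elsewhere. Stopping [jmin] at its zero
    only adds a nonnegative atom to [jmin''], hence to [w'']
    ([second_derivative_ge_extend0]). So [w'' >= kappa1 w] with
    [w 0 = w' 0 = 0], and comparison with the positive solution [j1] gives
    [w >= 0] ([sturm_comparison]): the Wronskian [w' j1 - w j1'] is nondecreasing
    and vanishes at the origin, so [w / j1] is nondecreasing, with limit [0] at
    the origin.

    The equation is an identity of distributions with a measure that may have
    atoms. It is first turned into the integral equation
    [j t = beta t + \int_(0, t) (t - r) kappa j dmu] ([weak_integral_equation]),
    by testing it against smooth approximations of piecewise linear hats; these
    are built from the function [exp (-1/y)]. The derivative of [j] is then an
    explicit function of bounded variation, and the monotonicity statements about
    Wronskians and quotients are proved without product rules for such functions: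
    the increments of these quantities over an interval from [a] to [c] are
    nonnegative up to [(c - a) * (N c - N a)], with [N] nondecreasing, and such
    errors sum to zero over fine partitions ([increments_ge_le]). *)

(** * Smooth cut-off functions *)

(** [flat k] is the function [y^-k exp (-1/y)] for [0 < y], extended by [0];
    the derivatives of [flat 0] are combinations of the [flat k]. *)
Definition flat (R : realType) (k : nat) (y : R) : R :=
  if 0 < y then y^-1 ^+ k * expR (- y^-1) else 0.

Lemma flat0_gt0 (R : realType) (y : R) : 0 < y -> 0 < flat 0 y.
Proof. by move=> y0; rewrite /flat y0 mul1r expR_gt0. Qed.

Lemma flat_le0 (R : realType) k (y : R) : y <= 0 -> flat k y = 0.
Proof. by move=> y0; rewrite /flat ltNge y0. Qed.

Lemma flat0_ge0 (R : realType) (y : R) : 0 <= flat 0 y.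
Proof. by have [/flat_le0->|/flat0_gt0/ltW] := leP y 0. Qed.

Lemma norm_flat_le (R : realType) k (y : R) :
  `|flat k y| <= (k.+2)`!%:R * y ^+ 2.
Proof.
have [y0|y0] := leP y 0.
  by rewrite flat_le0// normr0 mulr_ge0// sqr_ge0.
rewrite /flat y0 ger0_norm; last first.
  by rewrite mulr_ge0 ?expR_ge0// exprn_ge0// invr_ge0 ltW.
have h := @expR_ge1Dxn R y^-1 k.+1 _.
have {h} : y^-1 ^+ k.+2 / (k.+2)`!%:R <= expR y^-1.
  apply: le_trans (h _); last by rewrite invr_ge0 ltW.
  by rewrite lerDr.
have f0 : 0 < (k.+2)`!%:R :> R by rewrite ltr0n fact_gt0.
rewrite expRN ler_pdivrMr// => h.
rewrite ler_pdivrMr ?expR_gt0//.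
rewrite (_ : y^-1 ^+ k = y ^+ 2 * y^-1 ^+ k.+2); last first.
  by rewrite -(addn2 k) exprD mulrCA !exprVn mulfV ?mulr1// expf_neq0// gt_eqF.
rewrite -[leRHS]mulrA [leRHS]mulrCA ler_pM2l ?exprn_gt0//.
by rewrite mulrC.
Qed.

Lemma is_derive_inv (R : realType) (f : R -> R) (x d : R) :
  f x != 0 -> is_derive x (1 : R) f d ->
  is_derive x (1 : R) (fun y => (f y)^-1) (- (f x) ^- 2 * d).
Proof.
move=> fx0 [df <-]; apply: DeriveDef; first exact: derivableV.
by rewrite deriveV.
Qed.

(** A function that is [O(y^2)] at the origin has derivative [0] there. *)
Lemma is_derive_quadratic (R : realType) (f : R -> R) (C : R) :
  (forall y, `|f y| <= C * y ^+ 2) -> is_derive (0 : R) (1 : R) f 0.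
Proof.
move=> fC.
have f0 : f 0 = 0.
  by apply/eqP; rewrite -normr_le0 (le_trans (fC _))// expr0n mulr0.
have C0 : 0 <= C.
  by have := fC 1; rewrite expr1n mulr1; exact/le_trans.
suff h : h^-1 *: (f (h *: 1 + 0) - f 0) @[h --> (0 : R)^'] --> (0 : R).
  by apply: DeriveDef; [apply/cvg_ex; exists 0|exact: cvg_lim].
apply/cvgr0Pnorm_le => e e0; near=> y.
rewrite f0 subr0 addr0 [y *: 1]mulr1.
have y0 : y != 0 by near: y; exact: nbhs_dnbhs_neq.
rewrite normrM normfV ler_pdivrMl ?normr_gt0//.
apply: le_trans (fC _) _.
rewrite -real_normK ?num_real// expr2 mulrA mulrC ler_wpM2l//.
rewrite (@le_trans _ _ ((C + 1) * `|y|))// ?ler_wpM2r// ?lerDl//.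
rewrite -ler_pdivlMl ?ltr_wpDl//.
near: y; apply: dnbhs0_le.
by rewrite mulr_gt0// invr_gt0 ltr_wpDl.
Unshelve. all: by end_near. Qed.

Lemma is_derive_flat (R : realType) k (y : R) :
  is_derive y (1 : R) (flat k) (flat k.+2 y - k%:R * flat k.+1 y).
Proof.
have [y0|y0|->] := ltgtP y 0.
- rewrite !flat_le0 ?ltW// mulr0 subrr.
  apply: (@near_eq_is_derive _ _ _ (cst 0)).
  near=> z; rewrite flat_le0//; apply: ltW.
  by near: z; exact: lt_nbhsl.
- pose F : R -> R := fun y => y^-1 ^+ k * expR (- y^-1).
  suff dF : is_derive y 1 F (flat k.+2 y - k%:R * flat k.+1 y).
    apply: near_eq_is_derive dF.
    near=> z; rewrite /flat ifT//.
    by near: z; exact: lt_nbhsr.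
  rewrite /flat y0.
  have dV := is_derive_inv (f := id) (lt0r_neq0 y0) (is_derive_id y 1).
  have dE : is_derive y 1 (fun y : R => expR (- y^-1))
      (expR (- y^-1) * - (- y ^- 2 * 1)).
    by apply: (@is_derive1_comp _ expR (fun y : R => - y^-1)).
  have -> : F = (fun y => y^-1) ^+ k * (fun y => expR (- y^-1)).
    by apply/funext => z; rewrite /F !fctE.
  apply: is_derive_eq.
  rewrite /= -![_ *: _]/(_ * _) !fctE.
  have -> : y ^- 2 = y^-1 ^+ 2 by rewrite exprVn.
  case: k {F} => [|k] /=; first by rewrite /= !mul0r !expr0; ring.
  by rewrite !exprS; ring.
- rewrite !flat_le0// mulr0 subrr.
  exact/is_derive_quadratic/norm_flat_le.
Unshelve. all: by end_near. Qed.

(** A class of functions closed under differentiation: constants, the identity,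
    sums, products, inverses of nowhere vanishing functions, and composites with
    the [flat k]. Its members are therefore smooth. *)
Inductive elementary (R : realType) : (R -> R) -> Prop :=
| elementary_cst c : elementary (cst c)
| elementary_id : elementary id
| elementaryD f g : elementary f -> elementary g -> elementary (f \+ g)
| elementaryM f g : elementary f -> elementary g -> elementary (f \* g)
| elementaryV f : (forall x, f x != 0) -> elementary f ->
    elementary (fun x => (f x)^-1)
| elementary_flat k f : elementary f -> elementary (flat k \o f).

Lemma elementary_derive (R : realType) (f : R -> R) : elementary f ->
  exists2 g, elementary g & forall x, is_derive x (1 : R) f (g x).
Proof.
elim=> {f} [c||f g _ [f' ef df] _ [g' eg dg]|f g ef0 [f' ef df] eg0 [g' eg dg]
  |f f0 ef0 [f' ef df]|k f ef0 [f' ef df]].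
- by exists (cst 0) => [|x]; [exact: elementary_cst|exact: is_derive_cst].
- by exists (cst 1) => [|x]; [exact: elementary_cst|exact: is_derive_id].
- by exists (f' \+ g') => [|x]; [exact: elementaryD|exact: is_deriveD].
- exists ((f \* g') \+ (g \* f')) => [|x]; last exact: is_deriveM.
  by apply: elementaryD; exact: elementaryM.
- exists ((cst (-1) \* ((fun x => (f x)^-1) \* (fun x => (f x)^-1))) \* f').
    apply: elementaryM => //; apply: elementaryM; first exact: elementary_cst.
    by apply: elementaryM; exact: elementaryV.
  move=> x; apply: is_derive_eq (is_derive_inv (f0 x) (df x)) _.
  by rewrite /= -exprVn; ring.
- exists (((flat k.+2 \o f) \+ (cst (- k%:R) \* (flat k.+1 \o f))) \* f').
    apply: elementaryM => //; apply: elementaryD; first exact: elementary_flat.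
    by apply: elementaryM; [exact: elementary_cst|exact: elementary_flat].
  move=> x; apply: is_derive_eq.
    exact: (is_derive1_comp (is_derive_flat k (f x)) (df x)).
  by rewrite /=; ring.
Qed.

Lemma elementary_smooth (R : realType) (f : R -> R) : elementary f -> smooth f.
Proof.
move=> ef n x; have [g eg dg] : exists2 g, elementary g & derive1n n f = g.
  elim: n => [|n [g eg ng]]; first by exists f; rewrite ?derive1n0.
  have [g' eg' dg'] := elementary_derive eg.
  exists g' => //; rewrite derive1nS ng; apply/funext => y.
  by rewrite derive1E; have [] := dg' y.
by rewrite dg; have [g' _ /(_ x)[]] := elementary_derive eg.
Qed.

(** A smooth approximation of the positive part: [ramp y] is [0] for [y <= 0]
    and [y] for [1 <= y]. *)
Definition ramp (R : realType) (y : R) : R :=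
  y * (flat 0 y * (flat 0 y + flat 0 (1 - y))^-1).

Section ramp.
Variable R : realType.
Implicit Types y : R.

Let ramp_den_gt0 y : 0 < flat 0 y + flat 0 (1 - y).
Proof.
have [y0|y0] := leP y 0; last by rewrite ltr_pwDl ?flat0_gt0// flat0_ge0.
by rewrite ltr_wpDl ?flat0_ge0// flat0_gt0//; lra.
Qed.

Lemma elementary_ramp : elementary (@ramp R).
Proof.
have e1 : elementary (flat 0 \o @id R) by apply/elementary_flat/elementary_id.
have e2 : elementary (flat 0 \o (cst 1 \+ cst (-1) \* @id R)).
  apply/elementary_flat/elementaryD; first exact: elementary_cst.
  by apply: elementaryM; [exact: elementary_cst|exact: elementary_id].
have eV := elementaryV _ (elementaryD e1 e2).
rewrite (_ : @ramp R = id \* ((flat 0 \o id) \*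
    (fun y => (flat 0 (id y) + flat 0 (1 + (-1) * y))^-1))).
  apply: elementaryM; first exact: elementary_id.
  apply: elementaryM => //; apply: eV => y.
  by rewrite gt_eqF//= mulN1r.
by apply/funext => y; rewrite /ramp /= mulN1r.
Qed.

Lemma ramp_le0 y : y <= 0 -> ramp y = 0.
Proof. by move=> y0; rewrite /ramp flat_le0// mul0r mulr0. Qed.

Lemma ramp_ge1 y : 1 <= y -> ramp y = y.
Proof.
move=> y1; rewrite /ramp (@flat_le0 _ _ (1 - y)) ?subr_le0// addr0.
by rewrite divff ?mulr1// gt_eqF// flat0_gt0//; lra.
Qed.

Lemma ramp_approx y : `|ramp y - Num.max y 0| <= 1.
Proof.
have [y0|y0] := leP y 0; first by rewrite ramp_le0// subrr normr0.
have [y1|y1] := leP 1 y; first by rewrite ramp_ge1// subrr normr0.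
have := ramp_den_gt0 y; have := @flat0_ge0 R y; have := @flat0_ge0 R (1 - y).
rewrite /ramp; move: (flat _ _) (flat _ _) => a b b0 a0 d0.
rewrite (_ : _ - _ = - y * (b / (a + b))); last by field; rewrite gt_eqF.
rewrite normrM normrN !ger0_norm ?(ltW y0)//; last by rewrite divr_ge0// ltW.
rewrite mulr_ile1 ?divr_ge0 ?(ltW y0) ?(ltW y1) ?(ltW d0)//.
by rewrite ler_pdivrMr// mul1r lerDr.
Qed.

End ramp.

Lemma is_derive_continuous (R : realType) (f : R -> R) (x d : R) :
  is_derive x (1 : R) f d -> {for x, continuous f}.
Proof.
by move=> [df _]; apply/differentiable_continuous; exact/derivable1_diffP.
Qed.

Lemma is_derive_affine (R : realType) (c d r : R) :
  is_derive r (1 : R) (fun r => (r - c) / d) d^-1.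
Proof.
have -> : (fun r => (r - c) / d) = (fun r => d^-1 *: r) \- cst (c / d).
  by apply/funext => z; rewrite /= /GRing.scale/= mulrBl mulrC.
by apply: is_derive_eq; rewrite subr0 /GRing.scale/= mulr1.
Qed.

Lemma ramp_derivatives (R : realType) : exists G1 G2 : R -> R,
  [/\ forall y, is_derive y (1 : R) (@ramp R) (G1 y),
      forall y, is_derive y (1 : R) G1 (G2 y),
      continuous G2,
      (forall y, y < 0 -> G1 y = 0 /\ G2 y = 0) /\
      (forall y, 1 < y -> G1 y = 1 /\ G2 y = 0) &
      exists2 M, 0 < M & forall y, `|G2 y| <= M].
Proof.
have [G1 eG1 dG1] := elementary_derive (elementary_ramp R).
have [G2 eG2 dG2] := elementary_derive eG1.
have cG2 : continuous G2.
  move=> y; have [G3 _ dG3] := elementary_derive eG2.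
  exact: is_derive_continuous (dG3 y).
have uniq (f g : R -> R) (x a b : R) : is_derive x (1 : R) f a ->
    is_derive x (1 : R) g b -> (\near x, f x = g x) -> a = b.
  by move=> [_ <-] [_ <-] fg; exact: near_eq_derive.
have G1n y : y < 0 -> G1 y = 0.
  move=> y0; apply: (uniq _ (cst 0) y _ _ (dG1 y) (is_derive_cst _ _ _)).
  by near=> z; rewrite ramp_le0// ltW//; near: z; exact: lt_nbhsl.
have G1p y : 1 < y -> G1 y = 1.
  move=> y0; apply: (uniq _ id y _ _ (dG1 y) (is_derive_id _ _)).
  by near=> z; apply: ramp_ge1; apply: ltW; near: z; exact: lt_nbhsr.
have G2n y : y < 0 -> G2 y = 0.
  move=> y0; apply: (uniq _ (cst 0) y _ _ (dG2 y) (is_derive_cst _ _ _)).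
  by near=> z; rewrite G1n//; near: z; exact: lt_nbhsl.
have G2p y : 1 < y -> G2 y = 0.
  move=> y0; apply: (uniq _ (cst 1) y _ _ (dG2 y) (is_derive_cst _ _ _)).
  by near=> z; rewrite G1p//; near: z; exact: lt_nbhsr.
exists G1, G2; split=> //.
  by split=> y y0; split; [exact: G1n|exact: G2n|exact: G1p|exact: G2p].
have [//||c _ Mc] := @EVT_max R (fun y => `|G2 y|) 0 1.
  apply: continuous_subspaceT => y.
  by apply: continuous_comp; [exact: cG2|exact: norm_continuous].
exists (`|G2 c| + 1) => [|y]; first by rewrite ltr_wpDl.
have [y0|y0] := ltP y 0; first by rewrite G2n// normr0 addr_ge0.
have [y1|y1] := ltP 1 y; first by rewrite G2p// normr0 addr_ge0.
by rewrite (le_trans (Mc y _)) ?lerDl// in_itv/= y0 y1.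
Unshelve. all: by end_near. Qed.

(** * Approximate identity *)

(** The second derivative [G2] of the ramp has integral [1], as its primitive
    [G1] goes from [0] to [1]; its rescalings are an approximate identity,
    although [G2] need not be nonnegative. *)
Section approximate_identity.
Variables (R : realType) (G1 G2 : R -> R) (M : R).
Hypotheses (dG1 : forall y, is_derive y (1 : R) G1 (G2 y)).
Hypotheses (cG2 : continuous G2).
Hypotheses (G_lt0 : forall y, y < 0 -> G1 y = 0 /\ G2 y = 0).
Hypotheses (G_gt1 : forall y, 1 < y -> G1 y = 1 /\ G2 y = 0).
Hypotheses (M_gt0 : 0 < M) (G2M : forall y, `|G2 y| <= M).
Local Notation leb := (@lebesgue_measure R).

Let bump (x e r : R) := e^-1 * G2 ((r - x) / e).

Let is_derive_bump x e r :
  is_derive r (1 : R) (fun r => G1 ((r - x) / e)) (bump x e r).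
Proof.
rewrite /bump (mulrC e^-1).
exact: (is_derive1_comp (g := fun r => (r - x) / e)
  (dG1 ((r - x) / e)) (is_derive_affine x e r)).
Qed.

Let continuous_bump x e : continuous (bump x e).
Proof.
move=> r; apply: cvgM; first exact: cvg_cst.
apply: (@continuous_comp _ _ _ (fun r => (r - x) / e)); last exact: cG2.
exact: is_derive_continuous (is_derive_affine x e r).
Qed.

Let bump_eq0 x e r : 0 < e -> r \notin `[x - e, x + 2 * e] -> bump x e r = 0.
Proof.
move=> e0; rewrite in_itv/= negb_and -!ltNge => /orP[rx|rx].
  have [] := @G_lt0 ((r - x) / e); last by rewrite /bump => _ ->; rewrite mulr0.
  by rewrite ltr_pdivrMr// mul0r; lra.
have [] := @G_gt1 ((r - x) / e); last by rewrite /bump => _ ->; rewrite mulr0.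
by rewrite ltr_pdivlMr// mul1r; lra.
Qed.

Let bump_le x e r : 0 < e -> `|bump x e r| <= M / e.
Proof.
move=> e0; rewrite normrM normfV (gtr0_norm e0) [leLHS]mulrC.
by rewrite ler_pM2r ?invr_gt0.
Qed.

Let integral_bump x e : 0 < e ->
  \int[leb]_(r in `[x - e, x + 2 * e]) bump x e r = 1.
Proof.
move=> e0; rewrite /Rintegral.
have dF z := is_derive_bump x e z.
rewrite (@continuous_FTC2 _ (bump x e) (fun r => G1 ((r - x) / e))) //=.
- have [-> _] : G1 ((x + 2 * e - x) / e) = 1 /\ G2 ((x + 2 * e - x) / e) = 0.
    by apply: G_gt1; rewrite ltr_pdivlMr// mul1r; lra.
  have [-> _] : G1 ((x - e - x) / e) = 0 /\ G2 ((x - e - x) / e) = 0.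
    by apply: G_lt0; rewrite ltr_pdivrMr// mul0r; lra.
  by rewrite subr0.
- by lra.
- exact: continuous_subspaceT.
- split.
  + by move=> z _; have [] := dF z.
  + by apply: cvg_at_right_filter; exact: is_derive_continuous (dF _).
  + by apply: cvg_at_left_filter; exact: is_derive_continuous (dF _).
- by move=> z _; rewrite derive1E; have [_] := dF z.
Qed.

Lemma approximate_identity (j : R -> R) (T x : R) :
  0 < x -> x < T -> {in `]0, T[, continuous j} ->
  \int[leb]_(r in `]0, T[) (j r * (e^-1 * G2 ((r - x) / e))) @[e --> 0^'+]
    --> j x.
Proof.
move=> x0 xT cj; apply/cvgrPdist_le => h h0.
have h'0 : 0 < h / (3 * M) by rewrite divr_gt0// mulr_gt0.
have jx : {for x, continuous j} by apply: cj; rewrite in_itv/= x0 xT.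
move/cvgrPdist_le : (jx) => /(_ _ h'0) /nbhs_ballP[d /= d0 jd].
near=> e.
have e0 : 0 < e by near: e; exact: nbhs_right_gt.
have ed : 2 * e < d.
  by rewrite mulrC -ltr_pdivlMr//; near: e; apply: nbhs_right_lt; rewrite divr_gt0.
have ex : e < x by near: e; exact: nbhs_right_lt.
have eT : 2 * e < T - x.
  rewrite mulrC -ltr_pdivlMr//; near: e; apply: nbhs_right_lt.
  by rewrite divr_gt0// subr_gt0.
(* The rescaled bump lives on [x, x + e]; a larger interval keeps the endpoints
   away from the points where [G1] is not known explicitly. *)
set I := `[x - e, x + 2 * e].
have I0T : [set` I] `<=` `]0, T[.
  by move=> r /=; rewrite !in_itv/= => /andP[r1 r2]; apply/andP; split; lra.
have -> : \int[leb]_(r in `]0, T[) (j r * (e^-1 * G2 ((r - x) / e))) =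
    \int[leb]_(r in [set` I]) (j r * bump x e r).
  rewrite Rintegral_mkcond [RHS]Rintegral_mkcond; apply: eq_Rintegral => r _.
  rewrite !patchE; have [rI|rI] := boolP (r \in [set` I]).
    by rewrite mem_set//; apply: I0T; rewrite inE in rI.
  case: ifP => // _; rewrite -/(bump x e r) bump_eq0 ?mulr0//.
  by move: rI; rewrite mem_setE.
have cI : compact [set` I] by exact: segment_compact.
have mI : measurable [set` I] by exact: measurable_itv.
have cjI : {within [set` I], continuous j}.
  apply: continuous_in_subspaceT => r rI; apply: cj.
  by apply: I0T; rewrite inE in rI.
have cbI : {within [set` I], continuous (bump x e)} by exact: continuous_subspaceT.
have ib : leb.-integrable [set` I] (EFin \o bump x e).
  exact: continuous_compact_integrable.
have ijb : leb.-integrable [set` I] (EFin \o (fun r => j r * bump x e r)).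
  apply: continuous_compact_integrable => //.
  by move=> r; apply: cvgM; [exact: cjI|exact: cbI].
have ixb : leb.-integrable [set` I] (EFin \o (fun r => j x * bump x e r)).
  apply: continuous_compact_integrable => //.
  by move=> r; apply: cvgM; [exact: cvg_cst|exact: cbI].
rewrite -[X in `|X - _|]mulr1 -(integral_bump x e0) -RintegralZl// -RintegralB//.
have iB : leb.-integrable [set` I]
    (EFin \o (fun r => j x * bump x e r - j r * bump x e r)).
  exact: (integrableB _ ixb ijb).
apply: le_trans (le_normr_Rintegral _ iB) _ => //.
have ic c : leb.-integrable [set` I] (EFin \o cst c).
  apply: continuous_compact_integrable => //.
  by apply: continuous_subspaceT => ?; exact: cvg_cst.
apply: (@le_trans _ _ (\int[leb]_(r in [set` I]) (h / (3 * M) * (M / e)))).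
  apply: le_Rintegral => //.
  - exact: (integrable_norm iB).
  - exact: ic.
  - move=> r; rewrite /I /= in_itv/= => /andP[r1 r2].
  rewrite -mulrBl normrM ler_pM// ?bump_le//.
  by apply: jd; rewrite /ball/= ltr_norml; apply/andP; split; lra.
rewrite Rintegral_cst//= lebesgue_measure_itv/= lte_fin ifT; last lra.
rewrite -EFinB/= le_eqVlt; apply/orP; left; apply/eqP.
by field; rewrite !gt_eqF.
Unshelve. all: by end_near. Qed.

End approximate_identity.

(** * Smooth hat functions *)

Lemma elementary_comp (R : realType) (f g : R -> R) :
  elementary f -> elementary g -> elementary (f \o g).
Proof.
move=> ef eg; elim: ef => {f} [c||f f' _ ef _ ef'|f f' _ ef _ ef'|f f0 _ ef
  |k f _ ef].
- exact: elementary_cst.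
- exact: eg.
- exact: elementaryD ef ef'.
- exact: elementaryM ef ef'.
- by apply: elementaryV ef => y; exact: f0.
- exact: elementary_flat ef.
Qed.

Lemma elementary_affine (R : realType) (c d : R) :
  elementary (fun r => (r - c) / d).
Proof.
rewrite (_ : (fun r => _) = (id \+ cst (- c)) \* cst d^-1)//.
apply: elementaryM; last exact: elementary_cst.
by apply: elementaryD; [exact: elementary_id|exact: elementary_cst].
Qed.

Section three_points.
Variables (R : realType) (a b x : R).

(** The second divided difference of [u] at [a], [b], [x], up to a factor: it
    vanishes on affine functions, and the three points may come in any order. *)
Definition divided_difference (u : R -> R) : R :=
  (b - x) * u a + (x - a) * u b + (a - b) * u x.

(** The divided difference, in the parameter [y], of the positive part of
    [r - y], as a function of [r]; up to sign it is a piecewise linear hat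
    function. [smooth_hat e] is its smooth version at scale [e]. *)
Definition hat (r : R) : R := divided_difference (fun y => Num.max (r - y) 0).

Definition smooth_hat (e r : R) : R :=
  divided_difference (fun y => e * ramp ((r - y) / e)).

Lemma elementary_smooth_hat e : elementary (smooth_hat e).
Proof.
have el (c y : R) : elementary (fun r => c * (e * ramp ((r - y) / e))).
  rewrite (_ : (fun r => _) =
    cst c \* (cst e \* (@ramp R \o (fun r => (r - y) / e))))//.
  apply: elementaryM; first exact: elementary_cst.
  apply: elementaryM; first exact: elementary_cst.
  by apply: elementary_comp; [exact: elementary_ramp|exact: elementary_affine].
by apply: (elementaryD (elementaryD (el _ _) (el _ _))); exact: el.
Qed.

Lemma continuous_smooth_hat e : continuous (smooth_hat e).
Proof.
move=> r; have [g _ dg] := elementary_derive (elementary_smooth_hat e).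
exact: is_derive_continuous (dg r).
Qed.

Lemma continuous_hat : continuous hat.
Proof.
have cm (c y : R) : continuous (fun r => c * Num.max (r - y) 0).
  move=> r; apply: cvgM; first exact: cvg_cst.
  apply: (@continuous_comp _ _ _ (fun r => r - y) (fun z => Num.max z 0)).
    by apply: cvgB; [exact: cvg_id|exact: cvg_cst].
  by apply: continuous_max; [exact: cvg_id|exact: cvg_cst].
by move=> r; apply: cvgD; [apply: cvgD|]; exact: cm.
Qed.

Lemma smooth_hat_approx e r : 0 < e ->
  `|smooth_hat e r - hat r| <= (`|b - x| + `|x - a| + `|a - b|) * e.
Proof.
move=> e0.
have key y : `|e * ramp ((r - y) / e) - Num.max (r - y) 0| <= e.
  have -> : Num.max (r - y) 0 = e * Num.max ((r - y) / e) 0.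
    by rewrite maxr_pMr ?ltW// mulr0 mulrCA divff ?mulr1// gt_eqF.
  rewrite -mulrBr normrM gtr0_norm// -[leRHS]mulr1 ler_pM2l//.
  exact: ramp_approx.
pose d y := e * ramp ((r - y) / e) - Num.max (r - y) 0.
have -> : smooth_hat e r - hat r = divided_difference d.
  by rewrite /smooth_hat /hat /divided_difference /d; ring.
rewrite /divided_difference.
have kd c y : `|c * d y| <= `|c| * e by rewrite normrM ler_wpM2l// key.
rewrite (mulrDl (_ + _)) (mulrDl `|b - x|).
apply: le_trans (ler_normD _ _) _; apply: lerD => //.
by apply: le_trans (ler_normD _ _) _; exact: lerD.
Qed.

(** The support is compact since, to the right of the three points, the smooth
    hat is a divided difference of an affine function. *)
Lemma test_smooth_hat (T e : R) : 0 < e ->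
  a \in `]0, T - e[ -> b \in `]0, T - e[ -> x \in `]0, T - e[ ->
  test_function `]0, T[ (smooth_hat e).
Proof.
rewrite !in_itv/= => e0 /andP[a0 aT] /andP[b0 bT] /andP[x0 xT].
pose l := Num.min a (Num.min b x); pose u := Num.max a (Num.max b x).
have [la lb lx] : [/\ l <= a, l <= b & l <= x].
  by rewrite /l !ge_min !lexx !orbT.
have [ua ub ux] : [/\ a <= u, b <= u & x <= u].
  by rewrite /u !le_max !lexx !orbT.
have l0 : 0 < l by rewrite /l !lt_min a0 b0 x0.
have uT : u < T - e by rewrite /u !gt_max aT bT xT.
have supp : closure [set r | smooth_hat e r != 0] `<=` `[l, u + e].
  have cI : closed `[l, u + e] by exact: interval_closed.
  rewrite ((closure_id _).1 cI); apply: closureS => r /=; rewrite in_itv/=.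
  apply: contraNT; rewrite negb_and -!ltNge => /orP[rl|ur].
    have z y : l <= y -> e * ramp ((r - y) / e) = 0.
      by move=> ly; rewrite ramp_le0 ?mulr0// ler_pdivrMr// mul0r; lra.
    by rewrite /smooth_hat /divided_difference !z// !mulr0 !addr0.
  have z y : y <= u -> e * ramp ((r - y) / e) = r - y.
    move=> yu; have ry : 1 <= (r - y) / e by rewrite ler_pdivlMr// mul1r; lra.
    by rewrite ramp_ge1// mulrC divfK// gt_eqF.
  by rewrite /smooth_hat /divided_difference !z//; apply/eqP; ring.
split; first exact/elementary_smooth/elementary_smooth_hat.
  apply: (subclosed_compact _ _ supp); first exact: closed_closure.
  exact: segment_compact.
apply: subset_trans supp _ => r /=; rewrite !in_itv/= => /andP[lr ru].
by apply/andP; split; lra.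
Qed.

Lemma derive_smooth_hat (G1 G2 : R -> R) e r : 0 < e ->
  (forall y, is_derive y (1 : R) (@ramp R) (G1 y)) ->
  (forall y, is_derive y (1 : R) G1 (G2 y)) ->
  derive1n 2 (smooth_hat e) r =
  divided_difference (fun y => e^-1 * G2 ((r - y) / e)).
Proof.
move=> e0 dr dG.
have dc (F F' : R -> R) c y z : (forall y, is_derive y (1 : R) F (F' y)) ->
    is_derive z (1 : R) (fun r => c * F ((r - y) / e))
      (c * (F' ((z - y) / e) * e^-1)).
  move=> dF; have h := is_derive1_comp (g := fun r => (r - y) / e)
    (dF ((z - y) / e)) (is_derive_affine y e z).
  exact: (is_deriveZ c h).
have dd (F F' : R -> R) c z : (forall y, is_derive y (1 : R) F (F' y)) ->
    is_derive z (1 : R) (fun r => divided_difference (fun y => c * F ((r - y) / e)))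
     (divided_difference (fun y => (c / e) * F' ((z - y) / e))).
  move=> dF; have d3 k y := dc F F' (k * c) y z dF.
  have := is_deriveD (is_deriveD (d3 (b - x) a) (d3 (x - a) b)) (d3 (a - b) x).
  rewrite /divided_difference => h.
  rewrite (_ : (fun r => _) = (fun r => (b - x) * c * F ((r - a) / e)) +
    (fun r => (x - a) * c * F ((r - b) / e)) +
    (fun r => (a - b) * c * F ((r - x) / e))); last first.
    by apply/funext => t; rewrite !fctE !mulrA.
  by apply: is_derive_eq h _; ring.
rewrite (derive1nS _ 1) derive1n1.
have -> : (smooth_hat e)^`()%classic =
    (fun r => divided_difference (fun y => 1 * G1 ((r - y) / e))).
  apply/funext => t; rewrite derive1E; have [_] := dd _ _ e t dr.
  by rewrite divff// gt_eqF.
by rewrite derive1E; have [_ ->] := dd _ _ 1 r dG; rewrite mul1r.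
Qed.

End three_points.

(** * From distributions to an integral equation *)

Lemma within_continuous_bounded (R : realType) (h : R -> R) (a b : R) :
  {within `[a, b], continuous h} ->
  exists2 M, 0 <= M & forall r, r \in `[a, b] -> `|h r| <= M.
Proof.
move=> ch; have [ab|ba] := leP a b; last first.
  exists 0 => // r; rewrite in_itv/= => /andP[ar /(le_trans ar)].
  by rewrite leNgt ba.
have [|c _ Mc] := @EVT_max R (fun r => `|h r|) a b ab.
  by move=> r; apply: continuous_comp; [exact: ch|exact: norm_continuous].
by exists `|h c|.
Qed.

Lemma integrable_mul_continuous (R : realType)
    (mu : {measure set (measurableTypeR R) -> \bar R}) (D : set R) (T : R)
    (f h : R -> R) :
  measurable D -> D `<=` `[0, T] -> mu.-integrable D (EFin \o f) ->
  {within `[0, T], continuous h} ->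
  mu.-integrable D (EFin \o (fun r => f r * h r)).
Proof.
move=> mD DT fi ch.
have [M M0 hM] := within_continuous_bounded ch.
have -> : EFin \o (fun r => f r * h r) = ((EFin \o f) \* (EFin \o h))%E.
  by apply/funext => r; rewrite /= EFinM.
apply: integrableMl => //.
- apply: subspace_continuous_measurable_fun => //.
  exact: continuous_subspaceW ch.
- exists M; split; first exact: num_real.
  by move=> y My r /DT rT; apply: le_trans (hM r rT) _; exact: ltW.
Qed.

(** From here [f] is the density of the distributional second derivative of [j]
    on the open interval. *)
Section weak_equation.
Variables (R : realType) (mu : {measure set (measurableTypeR R) -> \bar R}).
Variables (T : R) (f j : R -> R).
Hypotheses (T_gt0 : 0 < T) (cj : {within `[0, T], continuous j}).
Hypothesis fi : mu.-integrable `]0, T[ (EFin \o f).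
Hypothesis weak : forall phi, test_function `]0, T[ phi ->
  \int[lebesgue_measure]_(t in `]0, T[) (j t * derive1n 2 phi t) =
  \int[mu]_(t in `]0, T[) (f t * phi t).

Let fci h : {within `[0, T], continuous h} ->
  mu.-integrable `]0, T[ (EFin \o (fun r => f r * h r)).
Proof. by apply: integrable_mul_continuous => //; exact: subset_itv_oo_cc. Qed.

(** The weak equation may be tested against hats: as [e] tends to [0], the left
    side converges by [approximate_identity], and the right side because the
    smooth hats converge uniformly and [f] is integrable. *)
Lemma weak_divided_difference a b x :
  a \in `]0, T[ -> b \in `]0, T[ -> x \in `]0, T[ ->
  divided_difference a b x j = \int[mu]_(r in `]0, T[) (f r * hat a b x r).
Proof.
move=> aT bT xT.
have [G1 [G2 [dG0 dG1 cG2 [Gn Gp] [M M0 GM]]]] := ramp_derivatives R.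
have cjo : {in `]0, T[, continuous j}.
  by move/(continuous_within_itvP _ T_gt0) : cj => [].
pose bump e y r := e^-1 * G2 ((r - y) / e).
pose L e := divided_difference a b x
  (fun y => \int[lebesgue_measure]_(r in `]0, T[) (j r * bump e y r)).
have cvgL : L e @[e --> 0^'+] --> divided_difference a b x j.
  have c1 c y : y \in `]0, T[ ->
      c * (\int[lebesgue_measure]_(r in `]0, T[) (j r * bump e y r))
        @[e --> 0^'+] --> c * j y.
    rewrite in_itv/= => /andP[y0 yT]; apply: cvgM; first exact: cvg_cst.
    exact: (approximate_identity dG1 cG2 Gn Gp M0 GM).
  by apply: cvgD; [apply: cvgD|]; exact: c1.
pose I e := \int[mu]_(r in `]0, T[) (f r * smooth_hat a b x e r).
have LI : \forall e \near 0^'+, L e = I e.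
  have near_small y : y \in `]0, T[ -> 0 < T - y.
    by rewrite in_itv/= => /andP[_]; rewrite subr_gt0.
  near=> e.
  have e0 : 0 < e by near: e; exact: nbhs_right_gt.
  have small y : y \in `]0, T[ -> e < T - y -> y \in `]0, T - e[.
    by rewrite !in_itv/= => /andP[-> _] ?; lra.
  rewrite /I -weak; last first.
    apply: test_smooth_hat => //; apply: small => //; near: e;
      apply: nbhs_right_lt; exact: near_small.
  have ijb y : lebesgue_measure.-integrable `]0, T[
      (EFin \o (fun r => j r * bump e y r)).
    have cb : continuous (bump e y).
      move=> s; apply: cvgM; first exact: cvg_cst.
      apply: (@continuous_comp _ _ _ (fun r => (r - y) / e)); last exact: cG2.
      by apply: cvgM; [apply: cvgB; [exact: cvg_id|exact: cvg_cst]|exact: cvg_cst].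
    have ic : lebesgue_measure.-integrable [set` `[0, T]]
        (EFin \o (fun r => j r * bump e y r)).
      apply: continuous_compact_integrable; first exact: segment_compact.
      move=> r; apply: cvgM; first exact: cj.
      exact: (continuous_subspaceT cb).
    by apply: integrableS ic => //; exact: subset_itv_oo_cc.
  have ijbc c y : lebesgue_measure.-integrable `]0, T[
      (EFin \o (fun r => c * (j r * bump e y r))).
    exact: (integrableZl _ _ (ijb y)).
  rewrite /L /divided_difference -!RintegralZl// -!RintegralD//; last first.
    exact: (integrableD _ (ijbc _ _) (ijbc _ _)).
  apply: eq_Rintegral => r _; rewrite (derive_smooth_hat _ _ _ _ e0 dG0 dG1).
  by rewrite /divided_difference /bump; ring.
have cvgI : I e @[e --> 0^'+] --> \int[mu]_(r in `]0, T[) (f r * hat a b x r).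
  pose C := `|b - x| + `|x - a| + `|a - b|.
  pose F := \int[mu]_(r in `]0, T[) `|f r|.
  have C0 : 0 <= C by rewrite !addr_ge0.
  have F0 : 0 <= F by apply: Rintegral_ge0.
  apply/cvgrPdist_le => h h0; near=> e.
  have e0 : 0 < e by near: e; exact: nbhs_right_gt.
  have ich : mu.-integrable `]0, T[ (EFin \o (fun r => f r * hat a b x r)).
    by apply: fci; apply: continuous_subspaceT; exact: continuous_hat.
  have ics : mu.-integrable `]0, T[
      (EFin \o (fun r => f r * smooth_hat a b x e r)).
    by apply: fci; apply: continuous_subspaceT; exact: continuous_smooth_hat.
  have iB : mu.-integrable `]0, T[ (EFin \o (fun r =>
      f r * hat a b x r - f r * smooth_hat a b x e r)).
    exact: (integrableB _ ich ics).
  rewrite -RintegralB//; apply: le_trans (le_normr_Rintegral _ iB) _ => //.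
  have ifc : mu.-integrable `]0, T[ (EFin \o (fun r => C * e * `|f r|)).
    exact: (integrableZl _ _ (integrable_norm fi)).
  apply: (@le_trans _ _ (\int[mu]_(r in `]0, T[) (C * e * `|f r|))).
    apply: le_Rintegral => //; first exact: integrable_norm iB.
    move=> r _; rewrite -mulrBr normrM mulrC ler_wpM2r// distrC.
    exact: smooth_hat_approx.
  rewrite RintegralZl//; last exact: integrable_norm.
  rewrite -/F (@le_trans _ _ (e * (C * F + 1)))//.
    by rewrite mulrDr mulr1 (mulrC C) -mulrA lerDl ltW.
  rewrite -ler_pdivlMr ?ltr_wpDl ?mulr_ge0//.
  near: e; apply: nbhs_right_le.
  by rewrite divr_gt0// ltr_wpDl ?mulr_ge0.
apply: (cvg_unique _ cvgL) => //.
apply: cvg_trans cvgI; apply: near_eq_cvg.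
by near=> e; apply/esym; near: e.
Unshelve. all: by end_near. Qed.

(** The function [D t = j t - H t], with [H] the double primitive of [f mu], has
    vanishing divided differences on the open interval, so it is affine there,
    and on the closed interval by continuity. *)
Lemma weak_integral_equation : j 0 = 0 -> exists beta, forall t,
  t \in `[0, T] ->
  j t = beta * t + \int[mu]_(r in `]0, T[) (f r * Num.max (t - r) 0).
Proof.
move=> j0.
pose H t := \int[mu]_(r in `]0, T[) (f r * Num.max (t - r) 0).
have T0 := T_gt0; pose a := T / 3; pose b := 2 * T / 3.
have aT : a \in `]0, T[ by rewrite in_itv/= /a; apply/andP; split; lra.
have bT : b \in `]0, T[ by rewrite in_itv/= /b; apply/andP; split; lra.
have ab : a - b != 0 by rewrite lt_eqF// subr_lt0 /a /b; lra.
have icm t : mu.-integrable `]0, T[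
    (EFin \o (fun r => f r * Num.max (t - r) 0)).
  apply: fci; apply: continuous_subspaceT => r.
  apply: (@continuous_comp _ _ _ (fun r => t - r) (fun z => Num.max z 0)).
    by apply: cvgB; [exact: cvg_cst|exact: cvg_id].
  by apply: continuous_max; [exact: cvg_id|exact: cvg_cst].
pose D t := j t - H t.
have DD x : x \in `]0, T[ -> divided_difference a b x D = 0.
  move=> xT; have := weak_divided_difference aT bT xT.
  have -> : \int[mu]_(r in `]0, T[) (f r * hat a b x r) =
      divided_difference a b x H.
    have ic c t : mu.-integrable `]0, T[
        (EFin \o (fun r => c * (f r * Num.max (t - r) 0))).
      exact: (integrableZl _ _ (icm t)).
    rewrite /divided_difference /H -!RintegralZl// -!RintegralD//; last first.
      exact: (integrableD _ (ic _ _) (ic _ _)).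
    apply: eq_Rintegral => r _; rewrite /hat /divided_difference.
    (* Positive parts of [r - t] and [t - r] differ by an affine function of
       [t], which divided differences do not see. *)
    have mm t : Num.max (r - t) 0 = Num.max (t - r) 0 + (r - t).
      by have [?|?] := leP (r - t) 0; have [?|?] := leP (t - r) 0; lra.
    by rewrite !mm; ring.
  rewrite /divided_difference /D => h.
  by rewrite !mulrBr; move: h; lra.
pose beta := (D a - D b) / (a - b); pose alpha := D a - beta * a.
have Daff x : x \in `]0, T[ -> D x = alpha + beta * x.
  move=> /DD; rewrite /divided_difference => h.
  have -> : D x = - ((b - x) * D a + (x - a) * D b) / (a - b).
    apply: (mulfI ab); rewrite mulrCA divff// mulr1; lra.
  by rewrite /alpha /beta; field.
have cH : continuous H.
  pose F := \int[mu]_(r in `]0, T[) `|f r|.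
  have F0 : 0 <= F by apply: Rintegral_ge0.
  have lipH s t : `|H s - H t| <= `|s - t| * F.
    rewrite /H -RintegralB//.
    have iB : mu.-integrable `]0, T[ (EFin \o (fun r =>
        f r * Num.max (s - r) 0 - f r * Num.max (t - r) 0)).
      exact: (integrableB _ (icm s) (icm t)).
    apply: le_trans (le_normr_Rintegral _ iB) _ => //.
    rewrite /F -RintegralZl//; last exact: integrable_norm.
    apply: le_Rintegral => //; first exact: integrable_norm iB.
      exact: (integrableZl _ _ (integrable_norm fi)).
    move=> r _; rewrite -mulrBr normrM mulrC ler_wpM2r//.
    have [?|?] := leP (s - r) 0; have [?|?] := leP (t - r) 0;
      rewrite ?subrr ?normr0// ?subr0 ?sub0r ?normrN; rewrite ler_norml;
      apply/andP; split; do ?[exact: normr_ge0];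
      have := ler_norm (s - t); have := ler_norm (t - s); rewrite distrC; lra.
  move=> t; apply/cvgrPdist_le => h h0; near=> s.
  apply: le_trans (lipH _ _) _; rewrite (@le_trans _ _ (`|t - s| * (F + 1)))//.
    by rewrite ler_wpM2l// lerDl.
  rewrite -ler_pdivlMr ?ltr_wpDl//; near: s.
  by apply: cvgr_dist_le; [exact: cvg_id|rewrite divr_gt0// ltr_wpDl].
have cG : continuous (fun t => H t + (alpha + beta * t)).
  move=> t; apply: cvgD; first exact: cH.
  apply: cvgD; first exact: cvg_cst.
  by apply: cvgM; [exact: cvg_cst|exact: cvg_id].
move/(continuous_within_itvP _ T_gt0) : (cj) => [_ cj0 cjT].
have jo x : x \in `]0, T[ -> j x = H x + (alpha + beta * x).
  by move=> xT; rewrite -Daff// /D; ring.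
have j0E : j 0 = H 0 + (alpha + beta * 0).
  apply: (cvg_unique _ cj0) => //.
  apply: cvg_trans (cvg_at_right_filter (cG 0)); apply: near_eq_cvg.
  near=> t; apply/esym/jo; rewrite in_itv/=; apply/andP; split.
    by near: t; exact: nbhs_right_gt.
  by near: t; exact: nbhs_right_lt.
have jTE : j T = H T + (alpha + beta * T).
  apply: (cvg_unique _ cjT) => //.
  apply: cvg_trans (cvg_at_left_filter (cG T)); apply: near_eq_cvg.
  near=> t; apply/esym/jo; rewrite in_itv/=; apply/andP; split.
    by near: t; exact: nbhs_left_gt.
  by near: t; exact: nbhs_left_lt.
have H0 : H 0 = 0.
  rewrite /H; under eq_Rintegral => r.
    rewrite inE/= in_itv/= => /andP[r0 _].
    rewrite (_ : Num.max (0 - r) 0 = 0) ?mulr0; last first.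
      by apply/max_idPr; rewrite sub0r oppr_le0 ltW.
    over.
  by rewrite Rintegral_cst// mul0r.
have alpha0 : alpha = 0 by move: j0E; rewrite j0 H0 mulr0; lra.
exists beta => t; rewrite in_itv/= => /andP[t0 tT].
rewrite -/(H t) addrC.
have [->|tn0] := eqVneq t 0; first by rewrite H0 j0 mulr0 addr0.
have [->|tnT] := eqVneq t T; first by rewrite jTE alpha0 add0r.
rewrite jo ?alpha0 ?add0r// in_itv/=.
by rewrite !lt_neqAle t0 tT tnT eq_sym tn0.
Unshelve. all: by end_near. Qed.

End weak_equation.

(** * Second derivatives that are measures *)

(** Summing the hypothesis over [n] intervals of equal length bounds
    [F t - F s] from below by [- (t - s) * (N t - N s) / n]. *)
Lemma increments_ge_le (R : realType) (F N : R -> R) (s t : R) : s <= t ->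
  (forall a c, s <= a -> a <= c -> c <= t ->
    - ((c - a) * (N c - N a)) <= F c - F a) ->
  F s <= F t.
Proof.
move=> st incr.
pose A := (t - s) * (N t - N s).
have step n : - (A / n.+1%:R) <= F t - F s.
  have n0 : 0 < n.+1%:R :> R by rewrite ltr0n.
  pose h := (t - s) / n.+1%:R; pose x k := s + k%:R * h.
  have h0 : 0 <= h by rewrite divr_ge0 ?subr_ge0// ltW.
  have xn : x n.+1 = t by rewrite /x /h mulrC divfK ?gt_eqF// subrKC.
  have xS k : x k.+1 = x k + h by rewrite /x -natr1; ring.
  have sx k : s <= x k by rewrite lerDl mulr_ge0.
  have xt k : (k <= n.+1)%N -> x k <= t.
    by move=> kn; rewrite -xn lerD2l ler_wpM2r// ler_nat.
  have -> : A / n.+1%:R = h * (N (x n.+1) - N (x 0%N)).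
    by rewrite xn /x mul0r addr0 /A /h; ring.
  have -> : F t - F s = F (x n.+1) - F (x 0%N) by rewrite xn /x mul0r addr0.
  suff ind k : (k <= n.+1)%N ->
      - (h * (N (x k) - N (x 0%N))) <= F (x k) - F (x 0%N) by exact: ind.
  elim: k => [|k ih] kn; first by rewrite !subrr mulr0 oppr0.
  have := incr (x k) (x k.+1) (sx k) _ (xt _ kn).
  have := ih (ltnW kn).
  rewrite {1 2}xS lerDl => + /(_ h0).
  rewrite addrAC subrr add0r; lra.
rewrite leNgt; apply/negP => Fts.
have d0 : 0 < F s - F t by rewrite subr_gt0.
have := @archi_boundP R (`|A| / (F s - F t)) _.
rewrite divr_ge0 ?(ltW d0)// => /(_ isT).
set n := Num.bound _; rewrite ltr_pdivrMr// => An.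
have n0 : 0 < n.+1%:R :> R by rewrite ltr0n.
have := step n; rewrite lerNl opprB ler_pdivlMr//.
have := ler_norm A; rewrite -natr1 mulrDr mulr1; lra.
Qed.

Section second_derivative.
Variables (R : realType) (mu : {measure set (measurableTypeR R) -> \bar R}).
Implicit Types (T : R) (f u p N : R -> R).

Lemma Rintegral_itv_split T f a c : mu.-integrable `]0, T] (EFin \o f) ->
  0 <= a -> a <= c -> c <= T ->
  \int[mu]_(r in `]0, c]) f r =
  \int[mu]_(r in `]0, a]) f r + \int[mu]_(r in `]a, c]) f r.
Proof.
move=> fi a0 ac cT.
have E : [set` `]0, c]] = [set` `]0, a]] `|` [set` `]a, c]] :> set R.
  apply/seteqP; split => r /=; rewrite !in_itv/=.
    by move=> /andP[r0 rc]; have [ra|ra] := leP r a; [left|right]; rewrite ?r0.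
  by move=> [/andP[r0 ra]|/andP[ra rc]]; apply/andP; split; lra.
rewrite E; apply: Rintegral_setU => //.
  rewrite -E; apply: integrableS fi => //; try exact: measurable_itv.
  by move=> r /=; rewrite !in_itv/= => /andP[-> rc]; exact: le_trans rc cT.
apply/disj_setPS => r [] /=; rewrite !in_itv/= => /andP[_ ra] /andP[ar _].
by move: ar; rewrite ltNge ra.
Qed.

(** [u'' = f mu] on the interval from [0] to [T], where [p] stands for the right
    derivative of [u] and the variation of [N] controls both the variation of
    [p] and the error made when [u] is replaced by its tangent. Atoms of [mu] are
    allowed; the one at [a] is not counted in the increment of [p] from [a]. *)
Definition has_second_derivative T f u p N :=
  mu.-integrable `]0, T] (EFin \o f) /\
  forall a c, 0 <= a -> a <= c -> c <= T ->
    [/\ `|u c - u a - p a * (c - a)| <= (c - a) * (N c - N a),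
        `|p c - p a| <= N c - N a &
        p c - p a = \int[mu]_(r in `]a, c]) f r].

(** The same with [u'' >= f mu]. *)
Definition second_derivative_ge T f u p N :=
  mu.-integrable `]0, T] (EFin \o f) /\
  forall a c, 0 <= a -> a <= c -> c <= T ->
    [/\ `|u c - u a - p a * (c - a)| <= (c - a) * (N c - N a),
        `|p c - p a| <= N c - N a &
        \int[mu]_(r in `]a, c]) f r <= p c - p a].

Lemma has_second_derivativeW T f u p N :
  has_second_derivative T f u p N -> second_derivative_ge T f u p N.
Proof.
move=> [fi h]; split=> // a c a0 ac cT.
by have [h1 h2 h3] := h a c a0 ac cT; split=> //; rewrite h3.
Qed.

Lemma integrable_sub_itv T f a c : mu.-integrable `]0, T] (EFin \o f) ->
  0 <= a -> c <= T -> mu.-integrable `]a, c] (EFin \o f).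
Proof.
move=> fi a0 cT; apply: integrableS fi; try exact: measurable_itv.
move=> r /=; rewrite !in_itv/= => /andP[ar rc].
by rewrite (le_lt_trans a0 ar) (le_trans rc cT).
Qed.

Lemma has_second_derivativeN T f u p N : has_second_derivative T f u p N ->
  has_second_derivative T (\- f) (\- u) (\- p) N.
Proof.
move=> [fi h]; split; first exact: (integrableN fi).
move=> a c a0 ac cT; have [h1 h2 h3] := h a c a0 ac cT; split=> /=.
- by rewrite (_ : _ - _ - _ = - (u c - u a - p a * (c - a))) ?normrN//; ring.
- by rewrite (_ : _ - _ = - (p c - p a)) ?normrN//; ring.
- rewrite (_ : _ - _ = - (p c - p a)); last by ring.
  rewrite h3 -mulN1r -RintegralZl//; last exact: integrable_sub_itv fi _ _.
  by apply: eq_Rintegral => r _; rewrite mulN1r.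
Qed.

Lemma second_derivative_geD T f u p N f' u' p' N' :
  second_derivative_ge T f u p N -> second_derivative_ge T f' u' p' N' ->
  second_derivative_ge T (f \+ f') (u \+ u') (p \+ p') (N \+ N').
Proof.
move=> [fi h] [fi' h']; split; first exact: (integrableD _ fi fi').
move=> a c a0 ac cT.
have [h1 h2 h3] := h a c a0 ac cT; have [h1' h2' h3'] := h' a c a0 ac cT.
split=> /=.
- rewrite (_ : u c + _ - _ - _ =
    (u c - u a - p a * (c - a)) + (u' c - u' a - p' a * (c - a))); last by ring.
  by apply: le_trans (ler_normD _ _) _; move: h1 h1'; lra.
- rewrite (_ : p c + _ - _ = (p c - p a) + (p' c - p' a)); last by ring.
  by apply: le_trans (ler_normD _ _) _; move: h2 h2'; lra.
- rewrite RintegralD//; first by move: h3 h3'; lra.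
  + exact: integrable_sub_itv fi _ _.
  + exact: integrable_sub_itv fi' _ _.
Qed.

Lemma second_derivative_ge_bounded T f u p N : 0 <= T ->
  second_derivative_ge T f u p N -> exists2 B, 0 <= B &
    forall a c, 0 <= a -> a <= c -> c <= T ->
      [/\ `|p a| <= B, `|u a| <= B & `|u c - u a| <= B * (c - a)].
Proof.
move=> T0 [_ h].
have h0 a : 0 <= a -> a <= T -> `|p a| <= `|p 0| + (N T - N 0).
  move=> a0 aT; have [_ h1 _] := h 0 a (lexx _) a0 aT.
  have [_ h2 _] := h a T a0 aT (lexx _).
  have := ler_normD (p 0) (p a - p 0); rewrite subrKC.
  by have := normr_ge0 (p T - p a); move: h1 h2; lra.
have N0 : 0 <= N T - N 0.
  by have [_ h1 _] := h 0 T (lexx _) T0 (lexx _); apply: le_trans h1.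
pose L := `|p 0| + (N T - N 0) + (N T - N 0).
have L0 : 0 <= L by rewrite addr_ge0// addr_ge0.
have lip a c : 0 <= a -> a <= c -> c <= T -> `|u c - u a| <= L * (c - a).
  move=> a0 ac cT; have [h1 _ _] := h a c a0 ac cT.
  have pa := h0 a a0 (le_trans ac cT).
  have Nac : N c - N a <= N T - N 0.
    have [_ g1 _] := h 0 a (lexx _) a0 (le_trans ac cT).
    have [_ g2 _] := h c T (le_trans a0 ac) cT (lexx _).
    by have := normr_ge0 (p T - p c); have := normr_ge0 (p a - p 0); lra.
  rewrite -(subrK (p a * (c - a)) (u c - u a)).
  apply: le_trans (ler_normD _ _) _.
  have ca : 0 <= c - a by rewrite subr_ge0.
  rewrite normrM (ger0_norm ca) /L [leRHS]mulrDl addrC lerD ?ler_wpM2r//.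
  by apply: le_trans h1 _; rewrite mulrC ler_wpM2r.
exists (L + L * T + `|u 0|) => [|a c a0 ac cT].
  by rewrite addr_ge0// addr_ge0// mulr_ge0.
have aT := le_trans ac cT.
have LT : 0 <= L * T by rewrite mulr_ge0.
split.
- apply: le_trans (h0 a a0 aT) _; have := normr_ge0 (u 0).
  by move: LT; rewrite /L; lra.
- have := ler_normD (u 0) (u a - u 0); rewrite subrKC => h1.
  have := lip 0 a (lexx _) a0 aT; rewrite subr0 => h2.
  have : L * a <= L * T by rewrite ler_wpM2l.
  by move: h1 h2 L0; lra.
- apply: le_trans (lip _ _ a0 ac cT) _; rewrite ler_wpM2r ?subr_ge0//.
  by rewrite -addrA lerDl addr_ge0.
Qed.

End second_derivative.

Section measure_second_derivative.
Variables (R : realType) (mu : {measure set (measurableTypeR R) -> \bar R}).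
Implicit Types (T : R) (f u p N : R -> R).

(** The atom that [mu] may have at [T] is harmless: it contributes to [p T], but
    not to [u], since the kernel [t - r] vanishes at [t = r = T]. *)
Lemma integral_equation_has_second_derivative T f u beta :
  mu.-integrable `]0, T] (EFin \o f) ->
  (forall t, t \in `[0, T] ->
    u t = beta * t + \int[mu]_(r in `]0, T[) (f r * Num.max (t - r) 0)) ->
  has_second_derivative mu T f u
    (fun t => beta + \int[mu]_(r in `]0, t]) f r)
    (fun t => \int[mu]_(r in `]0, t]) `|f r|).
Proof.
move=> fi ueq.
have fin := integrable_norm fi.
have restr t : 0 <= t -> t <= T ->
    \int[mu]_(r in `]0, T[) (f r * Num.max (t - r) 0) =
    \int[mu]_(r in `]0, t]) (f r * (t - r)).
  move=> t0 tT; rewrite Rintegral_mkcond [RHS]Rintegral_mkcond.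
  apply: eq_Rintegral => r _; rewrite !patchE !mem_setE !in_itv/=.
  have [r0|r0] := ltP 0 r; rewrite //=.
  have [rt|tr] := leP r t; last first.
    by case: ifP => // _; rewrite (_ : Num.max _ _ = 0) ?mulr0//;
      apply/max_idPr; rewrite subr_le0 ltW.
  have [rT|Tr] := ltP r T.
    by congr (_ * _); apply/max_idPl; rewrite subr_ge0.
  by rewrite (_ : t - r = 0) ?mulr0//; lra.
have fci (c d t : R) : 0 <= c -> d <= T ->
    mu.-integrable `]c, d] (EFin \o (fun r => f r * (t - r))).
  move=> c0 dT; apply: (@integrable_mul_continuous _ _ _ T) => //.
  - move=> r /=; rewrite !in_itv/= => /andP[cr rd].
    by rewrite (le_trans c0 (ltW cr)) (le_trans rd dT).
  - exact: integrable_sub_itv fi _ _.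
  - apply: continuous_subspaceT => r.
    by apply: cvgB; [exact: cvg_cst|exact: cvg_id].
split=> // a c a0 ac cT.
have aT := le_trans ac cT; have c0 := le_trans a0 ac.
have fa := integrable_sub_itv fi (lexx 0) aT.
have fac := integrable_sub_itv fi a0 cT.
have nac := integrable_sub_itv fin a0 cT.
rewrite (Rintegral_itv_split fi a0 ac cT) (Rintegral_itv_split fin a0 ac cT).
have nE (A B : R) : A + B - A = B by ring.
rewrite nE.
have pE (A B : R) : beta + (A + B) - (beta + A) = B by ring.
rewrite pE; split=> //; last exact: le_normr_Rintegral.
have ca : 0 <= c - a by rewrite subr_ge0.
have -> : u c - u a - (beta + \int[mu]_(r in `]0, a]) f r) * (c - a) =
    \int[mu]_(r in `]a, c]) (f r * (c - r)).
  rewrite !ueq ?in_itv/= ?a0 ?c0// !restr//.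
  have i1 : mu.-integrable `]0, T]
      (EFin \o (fun r => f r * (c - r))) by exact: fci.
  rewrite (Rintegral_itv_split i1 a0 ac cT).
  have -> : \int[mu]_(r in `]0, a]) (f r * (c - r)) =
      \int[mu]_(r in `]0, a]) (f r * (a - r)) +
      (\int[mu]_(r in `]0, a]) f r) * (c - a).
    rewrite -RintegralZr// -RintegralD//; [|exact: fci|].
      by apply: eq_Rintegral => r _; ring.
    exact: (integrableZr _ _ fa).
  by ring.
apply: le_trans (le_normr_Rintegral _ (fci _ _ _ a0 cT)) _ => //.
rewrite -RintegralZl//; apply: le_Rintegral => //.
- exact: integrable_norm (fci _ _ _ a0 cT).
- exact: (integrableZl _ _ nac).
- move=> r /=; rewrite in_itv/= => /andP[ar rc].
  rewrite normrM mulrC ler_wpM2r// ger0_norm; lra.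
Qed.

(** A positive solution that reaches zero at [t0] and is stopped there is a
    subsolution: its derivative jumps from [p t0 <= 0] up to [0]. *)
Lemma second_derivative_ge_extend0 T t0 k u p N :
  0 < t0 -> t0 <= T -> mu.-integrable `]0, T] (EFin \o k) ->
  mu.-integrable `]0, T] (EFin \o (fun r => k r * u r)) ->
  {for t0, continuous u} ->
  has_second_derivative mu t0 (fun r => k r * u r) u p N ->
  (forall r, 0 < r -> r < t0 -> 0 < u r) ->
  (forall r, t0 <= r -> u r = 0) ->
  exists p' N', second_derivative_ge mu T (fun r => k r * u r) u p' N'.
Proof.
move=> t00 t0T ik iku cu hu upos u0.
have t00' := ltW t00.
have [B B0 hB] := second_derivative_ge_bounded t00' (has_second_derivativeW hu).
(* If [p t0 > 0], then [p >= 0] on some interval that ends at [t0], because the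
   variation of [p] there is at most [sup u * K]; so [u] would be nondecreasing
   there, which contradicts [u > 0 = u t0]. *)
have pt0 : p t0 <= 0.
  rewrite leNgt; apply/negP => pt0.
  pose K := \int[mu]_(r in `]0, t0]) `|k r|.
  have K0 : 0 <= K by apply: Rintegral_ge0.
  pose e := p t0 / (K + 1).
  have K1 : 0 < K + 1 by rewrite ltr_wpDl.
  have e0 : 0 < e by rewrite divr_gt0.
  have [d /= d0 ud] : exists2 d, 0 < d & forall r, `|t0 - r| < d -> `|u r| <= e.
    move/cvgrPdist_le : cu => /(_ _ e0) /nbhs_ballP[d /= d0 ud].
    by exists d => // r /ud; rewrite u0// sub0r normrN.
  pose t1 := Num.max (t0 / 2) (t0 - d / 2).
  have t10 : 0 < t1 by rewrite lt_max divr_gt0.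
  have t1t0 : t1 < t0 by rewrite gt_max; apply/andP; split; lra.
  have t1d : t0 - t1 < d.
    have : t0 - d / 2 <= t1 by rewrite le_max lexx orbT.
    by lra.
  have pge c : t1 <= c -> c <= t0 -> 0 <= p c.
    move=> t1c ct0; have c0 : 0 <= c by rewrite (le_trans _ t1c)// ltW.
    have [_ _ pc] := hu.2 c t0 c0 ct0 (lexx _).
    have ik0 := integrable_sub_itv ik c0 t0T.
    have iku0 := integrable_sub_itv iku c0 t0T.
    have : p t0 - p c <= e * K.
      rewrite pc; apply: le_trans (ler_norm _) _.
      apply: le_trans (le_normr_Rintegral _ iku0) _ => //.
      apply: (@le_trans _ _ (e * \int[mu]_(r in `]c, t0]) `|k r|)).
        rewrite -RintegralZl//; last exact: integrable_norm.
        apply: le_Rintegral => //; first exact: integrable_norm.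
          exact: (integrableZl _ _ (integrable_norm ik0)).
        move=> r /=; rewrite in_itv/= => /andP[cr rt0].
        rewrite normrM mulrC ler_wpM2r// ud//.
        by rewrite ger0_norm; lra.
      rewrite ler_wpM2l ?(ltW e0)// /K.
      have ikn := integrable_norm (integrable_sub_itv ik (lexx 0) t0T).
      rewrite (Rintegral_itv_split ikn c0 ct0 (lexx _)) lerDr.
      by apply: Rintegral_ge0 => r _ /=.
    have : e * (K + 1) = p t0 by rewrite /e divfK// gt_eqF.
    by move: e0; lra.
  have : u t1 <= u t0.
    apply: (@increments_ge_le _ _ N) => [|a c t1a ac ct0]; first exact: ltW.
    have a0 : 0 <= a by rewrite (le_trans _ t1a)// ltW.
    have [h1 _ _] := hu.2 a c a0 ac ct0.
    have : 0 <= p a * (c - a).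
      by rewrite mulr_ge0 ?subr_ge0// pge// (le_trans ac).
    by move: h1; rewrite ler_norml => /andP[]; lra.
  by rewrite (u0 t0)// leNgt upos.
(* The jump [2 * B] of [N] at [t0] absorbs the jump of [p]. *)
exists (fun s => if s < t0 then p s else 0),
  (fun s => if s < t0 then N s else N t0 + 2 * B); split=> // a c a0 ac cT.
have zero_int b : t0 <= b -> \int[mu]_(r in `]b, c]) (k r * u r) = 0.
  move=> t0b; under eq_Rintegral => r.
    rewrite inE/= in_itv/= => /andP[br _].
    rewrite u0 ?mulr0; last by rewrite (le_trans t0b)// ltW.
    over.
  by rewrite Rintegral_cst// mul0r.
have [ct0|t0c] := ltP c t0.
  rewrite (le_lt_trans ac ct0).
  by have [h1 h2 h3] := hu.2 a c a0 ac (ltW ct0); split=> //; rewrite h3.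
have [at0|t0a] := ltP a t0; last first.
  by rewrite !u0// zero_int// !subrr mul0r subrr normr0 mulr0.
have [h1 h2 h3] := hu.2 a t0 a0 (ltW at0) (lexx _).
have [pB _ _] := hB a t0 a0 (ltW at0) (lexx _).
have N0 : 0 <= N t0 - N a by rewrite (le_trans _ h2).
rewrite (u0 c t0c); rewrite (u0 t0)// in h1; split.
- rewrite (_ : 0 - u a - p a * (c - a) =
    (0 - u a - p a * (t0 - a)) - p a * (c - t0)); last by ring.
  apply: le_trans (ler_normB _ _) _.
  have -> : (c - a) * (N t0 + 2 * B - N a) = (t0 - a) * (N t0 - N a) +
    ((c - t0) * (N t0 - N a) + (c - a) * (2 * B)) by ring.
  apply: lerD => //; rewrite normrM (@ger0_norm _ (c - t0)) ?subr_ge0//.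
  apply: (@le_trans _ _ (B * (c - t0))); first by rewrite ler_wpM2r ?subr_ge0.
  have x1 : 0 <= (c - t0) * (N t0 - N a) by rewrite mulr_ge0// subr_ge0.
  have x2 : 0 <= B * (t0 - a) by rewrite mulr_ge0 ?subr_ge0// ltW.
  have x3 : 0 <= B * (c - t0) by rewrite mulr_ge0 ?subr_ge0.
  by lra.
- by rewrite sub0r normrN; lra.
- rewrite sub0r.
  have split_ac : \int[mu]_(r in `]a, c]) (k r * u r) =
      \int[mu]_(r in `]a, t0]) (k r * u r) + \int[mu]_(r in `]t0, c]) (k r * u r).
    have := Rintegral_itv_split iku a0 ac cT.
    have := Rintegral_itv_split iku a0 (ltW at0) t0T.
    have := Rintegral_itv_split iku t00' t0c cT.
    lra.
  by rewrite split_ac zero_int// addr0 -h3; lra.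
Qed.

End measure_second_derivative.

(** * Sturm comparison *)

(** Here [W] is the Wronskian of [j] and [w]. Its increments from [a] to [c] are
    nonnegative up to an error [(c - a) * (N c - N a)], which [increments_ge_le]
    removes; so [W >= 0], and in the same way the quotient [w / j], whose
    derivative is [W / j^2], is nondecreasing. It tends to [0] at the origin. *)
Lemma sturm_comparison (R : realType)
    (mu : {measure set (measurableTypeR R) -> \bar R}) (T : R)
    (k j pj Nj g w pw Nw : R -> R) :
  0 < T -> mu.-integrable `]0, T] (EFin \o k) ->
  has_second_derivative mu T (fun r => k r * j r) j pj Nj ->
  second_derivative_ge mu T g w pw Nw ->
  (forall r, 0 < r -> r <= T -> k r * w r <= g r) ->
  (forall r, 0 < r -> r <= T -> 0 < j r) ->
  {within `[0, T], continuous j} ->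
  j 0 = 0 -> w 0 = 0 ->
  (fun h : R => h^-1 * (j h - j 0)) @ 0^'+ --> (1 : R) ->
  (fun h : R => h^-1 * (w h - w 0)) @ 0^'+ --> (0 : R) ->
  0 <= w T.
Proof.
move=> T0 ki hj hw kwg jpos cj j0 w0 dj dw.
have T0' := ltW T0.
have [Bj Bj0 bj] := second_derivative_ge_bounded T0' (has_second_derivativeW hj).
have [Bw Bw0 bw] := second_derivative_ge_bounded T0' hw.
have jge r : 0 <= r -> r <= T -> 0 <= j r.
  rewrite le_eqVlt => /predU1P[<- _|r0 rT]; first by rewrite j0.
  exact/ltW/jpos.
pose K t := \int[mu]_(r in `]0, t]) `|k r|.
pose D := 2 * (Bj * Bw).
have D0 : 0 <= D by rewrite mulr_ge0// mulr_ge0.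
pose N t := D * K t + (Bw * Nj t + Bj * Nw t).
pose W t := pw t * j t - w t * pj t.
have W_incr a c : 0 <= a -> a <= c -> c <= T ->
    - ((c - a) * (N c - N a)) <= W c - W a.
  move=> a0 ac cT; have aT := le_trans ac cT; have c0 := le_trans a0 ac.
  have ca : 0 <= c - a by rewrite subr_ge0.
  have [ej _ pje] := hj.2 a c a0 ac cT.
  have [ew _ pwe] := hw.2 a c a0 ac cT.
  have [pja _ _] := bj a c a0 ac cT.
  have [pwa _ _] := bw a c a0 ac cT.
  have kac := integrable_sub_itv ki a0 cT.
  have kn := integrable_norm ki.
  have gac := integrable_sub_itv hw.1 a0 cT.
  have kjac := integrable_sub_itv hj.1 a0 cT.
  have pot : - ((c - a) * (D * (K c - K a))) <=
      j c * (pw c - pw a) - w c * (pj c - pj a).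
    have -> : K c - K a = \int[mu]_(r in `]a, c]) `|k r|.
      by rewrite /K (Rintegral_itv_split kn a0 ac cT) addrC addKr.
    apply: (@le_trans _ _ (j c * \int[mu]_(r in `]a, c]) g r -
        w c * \int[mu]_(r in `]a, c]) (k r * j r))); last first.
      by rewrite pje lerD2r ler_wpM2l ?jge.
    have igc : mu.-integrable `]a, c] (EFin \o (fun r => j c * g r)).
      exact: (integrableZl _ _ gac).
    have ijc : mu.-integrable `]a, c] (EFin \o (fun r => w c * (k r * j r))).
      exact: (integrableZl _ _ kjac).
    have iknc : mu.-integrable `]a, c]
        (EFin \o (fun r => - ((c - a) * D) * `|k r|)).
      exact: (integrableZl _ _ (integrable_norm kac)).
    rewrite mulrA -mulNr -!RintegralZl//; last exact: integrable_norm.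
    rewrite -RintegralB//.
    apply: le_Rintegral => //; first exact: (integrableB _ igc ijc).
    move=> r /=; rewrite in_itv/= => /andP[ar rc].
    have r0 := le_lt_trans a0 ar; have rT := le_trans rc cT.
    apply: (@le_trans _ _ (j c * (k r * w r) - w c * (k r * j r))); last first.
      by rewrite lerD2r ler_wpM2l ?jge// kwg.
    rewrite (_ : j c * _ - _ = k r * ((j c - j r) * w r - (w c - w r) * j r));
      last by ring.
    rewrite mulNr lerNl; apply: le_trans (ler_norm _) _.
    rewrite normrN normrM mulrC ler_wpM2r//.
    have [_ jr jl] := bj r c (ltW r0) rc cT.
    have [_ wr wl] := bw r c (ltW r0) rc cT.
    apply: le_trans (ler_normB _ _) _; rewrite !normrM.
    have ra : c - r <= c - a by lra.
    have cr0 : 0 <= c - r by lra.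
    have y1 : `|j c - j r| * `|w r| <= Bj * (c - a) * Bw.
      rewrite ler_pM//; apply: le_trans jl _; exact: ler_wpM2l.
    have y2 : `|w c - w r| * `|j r| <= Bw * (c - a) * Bj.
      rewrite ler_pM//; apply: le_trans wl _; exact: ler_wpM2l.
    by move: y1 y2; rewrite /D; lra.
  have y1 : `|pw a * (j c - j a - pj a * (c - a))| <=
      Bw * ((c - a) * (Nj c - Nj a)) by rewrite normrM ler_pM.
  have y2 : `|pj a * (w c - w a - pw a * (c - a))| <=
      Bj * ((c - a) * (Nw c - Nw a)) by rewrite normrM ler_pM.
  have -> : W c - W a = (j c * (pw c - pw a) - w c * (pj c - pj a)) +
      pw a * (j c - j a - pj a * (c - a)) -
      pj a * (w c - w a - pw a * (c - a)) by rewrite /W; ring.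
  move: y1 y2; rewrite !ler_norml => /andP[y1 _] /andP[_ y2].
  by move: pot y1 y2; rewrite /N; lra.
have W_ge0 a : 0 <= a -> a <= T -> 0 <= W a.
  move=> a0 aT; have W0 : W 0 = 0 by rewrite /W j0 w0 mulr0 mul0r subrr.
  rewrite -W0; apply: (@increments_ge_le _ _ N) => // b c b0 bc ca.
  by apply: W_incr => //; exact: le_trans aT.
have quot s : 0 < s -> s <= T -> w s / j s <= w T / j T.
  move=> s0 sT.
  have sub_s : [set` `[s, T]] `<=` [set` `[0, T]].
    move=> r /=; rewrite !in_itv/= => /andP[sr ->].
    by rewrite (le_trans (ltW s0) sr).
  have [c csT jc] := @EVT_min R j s T sT (continuous_subspaceW sub_s cj).
  have jc0 : 0 < j c.
    by move: csT; rewrite in_itv/= => /andP[sc cT]; rewrite jpos// (lt_le_trans s0).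
  pose M t := (Bj * Nw t + Bw * Nj t) / (j c * j c).
  apply: (@increments_ge_le _ (fun t => w t / j t) M) => // a b sa ab bT.
  have a0 : 0 < a by exact: lt_le_trans sa.
  have b0 : 0 < b by exact: lt_le_trans ab.
  have aT := le_trans ab bT.
  have ba : 0 <= b - a by rewrite subr_ge0.
  have [ej Nj0 _] := hj.2 a b (ltW a0) ab bT.
  have [ew Nw0 _] := hw.2 a b (ltW a0) ab bT.
  have [_ ja _] := bj a b (ltW a0) ab bT.
  have [_ wa _] := bw a b (ltW a0) ab bT.
  have Nj1 : 0 <= Nj b - Nj a by exact: le_trans Nj0.
  have Nw1 : 0 <= Nw b - Nw a by exact: le_trans Nw0.
  have ja0 := jpos a a0 aT; have jb0 := jpos b b0 bT.
  have jca : j c <= j a by rewrite jc// in_itv/= sa aT.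
  have jcb : j c <= j b by rewrite jc// in_itv/= bT (le_trans sa ab).
  have y1 : `|j a * (w b - w a - pw a * (b - a))| <=
      Bj * ((b - a) * (Nw b - Nw a)) by rewrite normrM ler_pM.
  have y2 : `|w a * (j b - j a - pj a * (b - a))| <=
      Bw * ((b - a) * (Nj b - Nj a)) by rewrite normrM ler_pM.
  pose E := (b - a) * (Bj * (Nw b - Nw a) + Bw * (Nj b - Nj a)).
  have E0 : 0 <= E by rewrite mulr_ge0// addr_ge0// mulr_ge0.
  have num : - E <= w b * j a - w a * j b.
    have -> : w b * j a - w a * j b = W a * (b - a) +
      j a * (w b - w a - pw a * (b - a)) -
      w a * (j b - j a - pj a * (b - a)) by rewrite /W; ring.
    have : 0 <= W a * (b - a) by rewrite mulr_ge0// W_ge0// ltW.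
    move: y1 y2; rewrite !ler_norml => /andP[y1 _] /andP[_ y2].
    by move: y1 y2; rewrite /E; lra.
  have -> : (b - a) * (M b - M a) = E / (j c * j c) by rewrite /M /E; ring.
  have -> : w b / j b - w a / j a = (w b * j a - w a * j b) / (j a * j b).
    by field; rewrite !gt_eqF.
  apply: (@le_trans _ _ (- E / (j a * j b))).
    rewrite -mulNr !mulNr lerN2 ler_wpM2l// lef_pV2 ?posrE ?mulr_gt0//.
    by rewrite ler_pM// ltW.
  by rewrite ler_wpM2r// invr_ge0 mulr_ge0// ltW.
have jT := jpos T T0 (lexx _).
have q0 : w h / j h @[h --> 0^'+] --> (0 : R).
  have : (h^-1 * (w h - w 0)) / (h^-1 * (j h - j 0)) @[h --> 0^'+] -->
      (0 / 1 : R).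
    by apply: cvgM; [exact: dw|apply: cvgV; [exact: oner_neq0|exact: dj]].
  rewrite mul0r; apply: cvg_trans; apply: near_eq_cvg; near=> h.
  have h0 : 0 < h by near: h; exact: nbhs_right_gt.
  have hT : h <= T by near: h; exact: nbhs_right_le.
  rewrite w0 j0 !subr0; have := jpos h h0 hT => jh.
  by field; rewrite !gt_eqF.
have : 0 <= w T / j T.
  apply: (cvgr_to_le q0); near=> h; apply: quot.
    by near: h; exact: nbhs_right_gt.
  by near: h; exact: nbhs_right_le.
by rewrite pmulr_lge0// invr_gt0.
Unshelve. all: by end_near. Qed.

(** * Stopped solutions *)

Section stopped_solutions.
Variables (R : realType) (mu : {measure set (measurableTypeR R) -> \bar R}).
Implicit Types (k j : R -> R).

Lemma stopped_continuous k j t : stopped_jacobi_solution mu k j -> 0 < t ->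
  {for t, continuous j}.
Proof.
by move=> [/continuous_within_itvcyP[cj _] _ _ _ _] t0; apply: cj;
  rewrite in_itv/= t0.
Qed.

Lemma stopped_within_continuous k j T : stopped_jacobi_solution mu k j ->
  {within `[0, T], continuous j}.
Proof.
move=> [cj _ _ _ _]; apply: continuous_subspaceW cj => r /=.
by rewrite !in_itv/= => /andP[->].
Qed.

(** A stopped solution is either positive up to [t], or positive up to some
    [t0 <= t] and zero from there on. *)
Lemma stopped_dichotomy k j t : stopped_jacobi_solution mu k j -> 0 < t ->
  (forall s, 0 < s -> s <= t -> 0 < j s) \/
  exists t0, [/\ 0 < t0, t0 <= t, forall s, 0 < s -> s < t0 -> 0 < j s &
    forall s, t0 <= s -> j s = 0].
Proof.
move=> hj t0; have [cj j0 dj _ stop] := hj.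
have [pos|/existsNP[r]] := pselect (forall s, 0 < s -> s <= t -> 0 < j s).
  by left.
move=> /not_implyP[r0 /not_implyP[rt /negP]]; rewrite -leNgt => jr.
right.
have [d d0 jd] : exists2 d, 0 < d & forall s, 0 < s -> s < d -> 0 < j s.
  have [d /= d0 jd] := cvgr_gt _ dj _ ltr01; exists d => // s s0 sd.
  have := jd s; rewrite /ball_/= sub0r normrN gtr0_norm// => /(_ sd s0).
  by rewrite j0 subr0 pmulr_rgt0// invr_gt0.
(* The first zero is the supremum of the points up to which [j] is positive. *)
pose A := [set s | 0 < s /\ forall z, 0 < z -> z <= s -> 0 < j z].
have Ar s : A s -> s < r.
  by move=> [s0 As]; rewrite ltNge; apply/negP => /(As _ r0); rewrite ltNge jr.
have Ad : A (d / 2).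
  by split=> [|z z0 zd]; [rewrite divr_gt0|apply: jd => //; lra].
have hA : has_sup A.
  by split; [exists (d / 2)|exists r => s /Ar/ltW].
pose b := sup A.
have db : d / 2 <= b by apply: ub_le_sup => //; exact: hA.2.
have b0 : 0 < b by apply: lt_le_trans db; rewrite divr_gt0.
have br : b <= r by apply: ge_sup; [exact: hA.1|move=> s /Ar/ltW].
have jb s : 0 < s -> s < b -> 0 < j s.
  move=> s0 sb; have bs : 0 < b - s by rewrite subr_gt0.
  have [z [_ Az] sz] := sup_adherent bs hA.
  by apply: Az => //; rewrite ltW//; move: sz; rewrite -/b; lra.
have cb : {for b, continuous j} by exact: stopped_continuous hj b0.
have jb0 : j b = 0.
  apply/eqP; rewrite eq_le; apply/andP; split; last first.
    have cl : j z @[z --> b^'-] --> j b by exact: cvg_at_left_filter.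
    apply: (cvgr_to_ge cl); near=> z; apply/ltW/jb.
      by near: z; exact: nbhs_left_gt.
    by near: z; exact: nbhs_left_lt.
  rewrite leNgt; apply/negP => jbp.
  have [e /= e0 je] : exists2 e, 0 < e & forall z, `|b - z| < e -> 0 < j z.
    have near_b : \forall z \near b, 0 < j z by exact: (cvgr_gt _ cb _ jbp).
    move/nbhs_ballP : near_b => [e /= e0 je].
    by exists e => // z; exact: je.
  have Ae : A (b + e / 2).
    split=> [|z z0 ze]; first by rewrite addr_gt0// divr_gt0.
    have [/jb/(_)|bz] := ltP z b; first exact.
    by apply: je; rewrite distrC ger0_norm; lra.
  have := ub_le_sup hA.2 Ae; rewrite -/b; lra.
exists b; split=> //; first exact: le_trans rt.
move=> s; apply: stop; split=> // z z0 zb.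
by rewrite gt_eqF// jb.
Unshelve. all: by end_near. Qed.

Lemma stopped_ge0 k j t : stopped_jacobi_solution mu k j -> 0 <= t -> 0 <= j t.
Proof.
move=> hj; rewrite le_eqVlt => /predU1P[<-|t0]; first by have [_ ->] := hj.
have [/(_ t t0 (lexx _))/ltW//|[b [b0 bt _ jb]]] := stopped_dichotomy hj t0.
by rewrite jb.
Qed.

Lemma stopped_has_second_derivative k j T :
  locally_integrable_on_halfline mu k -> stopped_jacobi_solution mu k j ->
  0 < T -> (forall t, 0 < t -> t < T -> 0 < j t) ->
  exists p N, has_second_derivative mu T (fun r => k r * j r) j p N.
Proof.
move=> ki hj T0 jpos; have [cj j0 _ eqj _] := hj.
have cT : {within `[0, T], continuous j} by exact: stopped_within_continuous hj.
have kji : mu.-integrable [set` `[0, T]] (EFin \o (fun r => k r * j r)).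
  by apply: integrable_mul_continuous cT => //; exact: measurable_itv.
have kjo : mu.-integrable `]0, T[ (EFin \o (fun r => k r * j r)).
  by apply: integrableS kji => //; exact: subset_itv_oo_cc.
have kjc : mu.-integrable `]0, T] (EFin \o (fun r => k r * j r)).
  by apply: integrableS kji => //; exact: subset_itv_oc_cc.
have [beta jE] := weak_integral_equation T0 cT kjo (eqj T jpos) j0.
do 2 eexists; exact: integral_equation_has_second_derivative kjc jE.
Qed.

Lemma locally_integrable_oc k T : locally_integrable_on_halfline mu k ->
  mu.-integrable `]0, T] (EFin \o k).
Proof.
move=> /(_ T) ki; apply: integrableS ki; try exact: measurable_itv.
exact: subset_itv_oc_cc.
Qed.

End stopped_solutions.

Lemma eq_cvg_at_right (R : realType) (F G : R -> R) (x l : R) : F =1 G ->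
  F @ x^'+ --> l -> G @ x^'+ --> l.
Proof. by move=> /funext ->. Qed.

Section stopped_comparison.
Variables (R : realType) (mu : {measure set (measurableTypeR R) -> \bar R}).
Implicit Types (k j : R -> R).

(** [sturm_comparison] against a stopped solution before its first zero. *)
Lemma stopped_sturm_comparison k j T g w pw Nw :
  locally_integrable_on_halfline mu k -> stopped_jacobi_solution mu k j ->
  0 < T -> (forall r, 0 < r -> r <= T -> 0 < j r) ->
  second_derivative_ge mu T g w pw Nw ->
  (forall r, 0 < r -> r <= T -> k r * w r <= g r) ->
  w 0 = 0 -> (fun h : R => h^-1 * (w h - w 0)) @ 0^'+ --> (0 : R) ->
  0 <= w T.
Proof.
move=> ki hj T0 jpos hw kwg w0 dw; have [_ j0 dj _ _] := hj.
have [|p [N hp]] := stopped_has_second_derivative ki hj T0.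
  by move=> t t0 tT; apply: jpos => //; exact: ltW.
apply: (sturm_comparison T0 _ hp hw kwg jpos _ j0 w0 dj dw).
  exact: locally_integrable_oc.
exact: stopped_within_continuous hj.
Qed.

(** Stopped solutions are nondecreasing in the coefficient. *)
Lemma stopped_monotone k1 k2 j1 j2 t :
  locally_integrable_on_halfline mu k1 -> locally_integrable_on_halfline mu k2 ->
  stopped_jacobi_solution mu k1 j1 -> stopped_jacobi_solution mu k2 j2 ->
  (forall r, k1 r <= k2 r) -> 0 <= t -> j1 t <= j2 t.
Proof.
move=> k1i k2i hj1 hj2 k12; rewrite le_eqVlt => /predU1P[<-|t0].
  by have [_ -> _ _ _] := hj1; have [_ -> _ _ _] := hj2.
have [pos1|[b [b0 bt _ jb]]] := stopped_dichotomy hj1 t0; last first.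
  by rewrite jb//; apply: stopped_ge0 hj2 (ltW t0).
(* It suffices to compare up to the first zero of [j2], which then cannot come
   before that of [j1]. *)
have compare T : 0 < T -> T <= t -> (forall r, 0 < r -> r < T -> 0 < j2 r) ->
    j1 T <= j2 T.
  move=> T0 Tt pos2.
  have pos1' r : 0 < r -> r <= T -> 0 < j1 r.
    by move=> r0 rT; apply: pos1 => //; exact: le_trans Tt.
  have [|p1 [N1 h1]] := stopped_has_second_derivative k1i hj1 T0.
    by move=> r r0 /ltW; exact: pos1'.
  have [p2 [N2 h2]] := stopped_has_second_derivative k2i hj2 T0 pos2.
  have hw := second_derivative_geD (has_second_derivativeW h2)
    (has_second_derivativeW (has_second_derivativeN h1)).
  have [_ j10 dj1 _ _] := hj1; have [_ j20 dj2 _ _] := hj2.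
  have : 0 <= (j2 \+ \- j1) T.
    apply: (stopped_sturm_comparison k1i hj1 T0 pos1' hw).
    - move=> r r0 rT /=; rewrite mulrBr lerD2r ler_wpM2r//.
      by apply: stopped_ge0 hj2 (ltW r0).
    - by rewrite /= j10 j20 subrr.
    - have dB := cvgB dj2 dj1; rewrite subrr in dB.
      apply: (eq_cvg_at_right _ (dB _)) => h.
      by rewrite !fctE /=; ring.
  by rewrite /= subr_ge0.
have [pos2|[b [b0 bt pos2 jb]]] := stopped_dichotomy hj2 t0.
  by apply: compare => // r r0 /ltW; exact: pos2.
have := compare b b0 bt pos2; rewrite jb// leNgt pos1//.
Qed.

(** Unlike [stopped_has_second_derivative], this holds past the first zero. *)
Lemma stopped_second_derivative_ge k j T :
  locally_integrable_on_halfline mu k -> stopped_jacobi_solution mu k j ->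
  0 < T ->
  exists p N, second_derivative_ge mu T (fun r => k r * j r) j p N.
Proof.
move=> ki hj T0; have [pos|[b [b0 bT pos jb]]] := stopped_dichotomy hj T0.
  have [|p [N h]] := stopped_has_second_derivative ki hj T0.
    by move=> r r0 /ltW; exact: pos.
  by exists p, N; exact: has_second_derivativeW.
have [p [N h]] := stopped_has_second_derivative ki hj b0 pos.
apply: (second_derivative_ge_extend0 b0 bT _ _ _ h pos jb).
- exact: locally_integrable_oc.
- apply: (integrable_mul_continuous (T := T)).
  + exact: measurable_itv.
  + exact: subset_itv_oc_cc.
  + exact: locally_integrable_oc.
  + exact: stopped_within_continuous hj.
- exact: stopped_continuous hj b0.
Qed.

(** The choices [s = 1] and [s = -1] give the maximum and the minimum. *)
Lemma locally_integrable_comb k1 k2 (s : R) :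
  locally_integrable_on_halfline mu k1 -> locally_integrable_on_halfline mu k2 ->
  locally_integrable_on_halfline mu
    (fun t => 2^-1 * (k1 t + k2 t + s * `|k1 t - k2 t|)).
Proof.
move=> i1 i2 T.
have iD : mu.-integrable `[0, T] (EFin \o (fun t => k1 t + k2 t)).
  exact: (integrableD _ (i1 T) (i2 T)).
have iB : mu.-integrable `[0, T] (EFin \o (fun t => k1 t - k2 t)).
  exact: (integrableB _ (i1 T) (i2 T)).
have iN : mu.-integrable `[0, T] (EFin \o (fun t => s * `|k1 t - k2 t|)).
  exact: (integrableZl _ s (integrable_norm iB)).
have iS : mu.-integrable `[0, T]
    (EFin \o (fun t => k1 t + k2 t + s * `|k1 t - k2 t|)).
  exact: (integrableD _ iD iN).
exact: (integrableZl _ _ iS).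
Qed.

Lemma locally_integrable_max k1 k2 :
  locally_integrable_on_halfline mu k1 -> locally_integrable_on_halfline mu k2 ->
  locally_integrable_on_halfline mu (fun t => Num.max (k1 t) (k2 t)).
Proof.
move=> i1 i2; have := locally_integrable_comb 1 i1 i2.
congr (locally_integrable_on_halfline mu _); apply/funext => t.
by rewrite mul1r maxr_absE mulrC.
Qed.

Lemma locally_integrable_min k1 k2 :
  locally_integrable_on_halfline mu k1 -> locally_integrable_on_halfline mu k2 ->
  locally_integrable_on_halfline mu (fun t => Num.min (k1 t) (k2 t)).
Proof.
move=> i1 i2; have := locally_integrable_comb (-1) i1 i2.
congr (locally_integrable_on_halfline mu _); apply/funext => t.
by rewrite mulN1r minr_absE mulrC.
Qed.

End stopped_comparison.

Unset Implicit Arguments.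
Set Strict Implicit.

Theorem mainTheorem5 (R : realType)
    (mu : {measure set (measurableTypeR R) -> \bar R})
    (hmu : locally_finite_on_halfline mu)
    (kappa1 kappa2 : R -> R)
    (hkappa1 : locally_integrable_on_halfline mu kappa1)
    (hkappa2 : locally_integrable_on_halfline mu kappa2)
    (j1 j2 jmax jmin : R -> R)
    (hj1 : stopped_jacobi_solution mu kappa1 j1)
    (hj2 : stopped_jacobi_solution mu kappa2 j2)
    (hjmax : stopped_jacobi_solution mu
      (fun t => Num.max (kappa1 t) (kappa2 t)) jmax)
    (hjmin : stopped_jacobi_solution mu
      (fun t => Num.min (kappa1 t) (kappa2 t)) jmin) :
  forall t : R, 0 <= t -> jmax t + jmin t >= j1 t + j2 t.
Proof.
have imax := locally_integrable_max hkappa1 hkappa2.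
have imin := locally_integrable_min hkappa1 hkappa2.
have max1 r : 0 <= r -> j1 r <= jmax r.
  by apply: (stopped_monotone hkappa1 imax hj1 hjmax) => s; rewrite le_max lexx.
have max2 r : 0 <= r -> j2 r <= jmax r.
  apply: (stopped_monotone hkappa2 imax hj2 hjmax) => s.
  by rewrite le_max lexx orbT.
have min2 r : 0 <= r -> jmin r <= j2 r.
  apply: (stopped_monotone imin hkappa2 hjmin hj2) => s.
  by rewrite ge_min lexx orbT.
move=> t; rewrite le_eqVlt => /predU1P[<-|t0].
  have [_ -> _ _ _] := hj1; have [_ -> _ _ _] := hj2.
  by have [_ -> _ _ _] := hjmax; have [_ -> _ _ _] := hjmin.
have t0' := ltW t0; have min0 := stopped_ge0 hjmin t0'.
have [pos1|[b [_ bt _ j1b]]] := stopped_dichotomy hj1 t0; last first.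
  by rewrite (j1b t bt) add0r; have := max2 t t0'; lra.
have [pos2|[b [_ bt _ j2b]]] := stopped_dichotomy hj2 t0; last first.
  by rewrite (j2b t bt) addr0; have := max1 t t0'; lra.
have [|p1 [N1 h1]] := stopped_has_second_derivative hkappa1 hj1 t0.
  by move=> r r0 /ltW; exact: pos1.
have [|p2 [N2 h2]] := stopped_has_second_derivative hkappa2 hj2 t0.
  by move=> r r0 /ltW; exact: pos2.
have [pM [NM hM]] := stopped_second_derivative_ge imax hjmax t0.
have [pm [Nm hm]] := stopped_second_derivative_ge imin hjmin t0.
(* [w'' >= g mu] for [w = jmax + jmin - j1 - j2], with [g] the corresponding
   combination of the products of coefficient and solution. *)
have hw := second_derivative_geD (second_derivative_geD hM hm)
  (second_derivative_geD
    (has_second_derivativeW (has_second_derivativeN h1))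
    (has_second_derivativeW (has_second_derivativeN h2))).
suff : 0 <= ((jmax \+ jmin) \+ ((\- j1) \+ (\- j2))) t by rewrite /=; lra.
have [_ j10 dj1 _ _] := hj1; have [_ j20 dj2 _ _] := hj2.
have [_ jM0 djM _ _] := hjmax; have [_ jm0 djm _ _] := hjmin.
apply: (stopped_sturm_comparison hkappa1 hj1 t0 pos1 hw).
- move=> r r0 rt /=.
  (* [g - kappa1 * w] is [(kappa2 - kappa1) * (jmax - j2)] where
     [kappa1 <= kappa2], and [(kappa1 - kappa2) * (j2 - jmin)] elsewhere. *)
  have := max2 r (ltW r0); have := min2 r (ltW r0).
  move=> m2 M2; have [k12|k21] := leP (kappa1 r) (kappa2 r).
    have : 0 <= (kappa2 r - kappa1 r) * (jmax r - j2 r).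
      by rewrite mulr_ge0// subr_ge0.
    by lra.
  have : 0 <= (kappa1 r - kappa2 r) * (j2 r - jmin r).
    by rewrite mulr_ge0// subr_ge0// ltW.
  by lra.
- by rewrite /= j10 j20 jM0 jm0; ring.
- have dB := cvgB (cvgD djM djm) (cvgD dj1 dj2); rewrite subrr in dB.
  apply: (eq_cvg_at_right _ (dB _ _ _)) => h.
  by rewrite !fctE /=; ring.
Qed.
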